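(* Let $G$ be a graph with $n$ vertices and $m$ edges. The set $S_G\subset\mathbb{R}^{3n}$ of disk packings with contact graph $G$, if not empty, is a smooth submanifold of $\mathbb{R}^{3n}$ of dimension $3n-m$.
   Context: A (planar) disk packing $(\mathbf p,\mathbf r)$ of $n$ disks consists of centers $\mathbf p=(\mathbf p_1,\dots,\mathbf p_n)\in(\mathbb{R}^2)^n$ and radii $\mathbf r=(r_1,\dots,r_n)$, $r_i>0$, such that the disks have pairwise disjoint interiors; it is regarded as a point of $\mathbb{R}^{3n}$. Let $G$ be a graph with vertex set $\{1,\dots,n\}$. $S_G\subset\mathbb{R}^{3n}$ is the set of disk packings in which exactly the pairs $ij$ that are edges of $G$ are in contact: $\|\mathbf p_i-\mathbf p_j\|=r_i+r_j$ for $ij$ an edge of $G$ and $\|\mathbf p_i-\mathbf p_j\|>r_i+r_j$ for all other pairs $i\neq j$. *)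

(* Defs.v *)
From mathcomp Require Import all_boot all_order all_algebra.
From mathcomp Require Import all_classical all_reals all_analysis.

Set Implicit Arguments.
Unset Strict Implicit.
Unset Printing Implicit Defensive.

Import Order.TTheory GRing.Theory Num.Theory.
Import numFieldNormedType.Exports.

Local Open Scope classical_set_scope.
Local Open Scope ring_scope.

(* Being of class C^k on U means that all iterated coordinate partial
   derivatives of order at most k exist and are continuous on U. Only meant for
   open U, so that these notions depend only on the values of f on U. *)
Fixpoint class_C (R : realType) (N M k : nat) (U : set 'rV[R]_N)
    (f : 'rV[R]_N -> 'rV[R]_M) : Prop :=
  {in U, continuous f} /\
  if k is k'.+1 then
    forall i : 'I_N,
      {in U, forall x, derivable f x (delta_mx 0 i)} /\
      class_C k' U (fun x => 'D_(delta_mx 0 i) f x)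
  else True.

Definition smooth_on (R : realType) (N M : nat) (U : set 'rV[R]_N)
    (f : 'rV[R]_N -> 'rV[R]_M) : Prop :=
  forall k, class_C k U f.

Definition diffeomorphism_on (R : realType) (N : nat) (U V : set 'rV[R]_N)
    (phi psi : 'rV[R]_N -> 'rV[R]_N) : Prop :=
  [/\ phi @` U = V, {in U, cancel phi psi},
      smooth_on U phi & smooth_on V psi].

(* R^k x {0} inside R^N *)
Definition coord_slice (R : realType) (N k : nat) : set 'rV[R]_N :=
  [set y | forall i : 'I_N, (k <= i)%N -> y 0 i = 0].

(* Embedded submanifolds of R^N, by slice charts: around each of its points, S
   is straightened to R^k x {0} by a diffeomorphism between open subsets of
   R^N. *)
Definition smooth_submanifold (R : realType) (N k : nat)
    (S : set 'rV[R]_N) : Prop :=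
  (k <= N)%N /\
  forall x, S x ->
    exists (U V : set 'rV[R]_N) (phi psi : 'rV[R]_N -> 'rV[R]_N),
      [/\ open U, open V, U x, diffeomorphism_on U V phi psi
        & phi @` (S `&` U) = coord_slice k `&` V].

(* The library norm on row vectors is the max norm, hence this definition. *)
Definition euclidean_norm (R : realType) (d : nat) (v : 'rV[R]_d) : R :=
  Num.sqrt (\sum_(j < d) v 0 j ^+ 2).

Definition disk (R : realType) (c : 'rV[R]_2) (r : R) : set 'rV[R]_2 :=
  [set z | euclidean_norm (z - c) <= r].

(* A point of R^(3n) is a row vector of length 2n + n: first the n centers, one
   after the other, then the n radii. *)
Definition center (R : realType) (n : nat) (x : 'rV[R]_(n * 2 + n))
    (i : 'I_n) : 'rV[R]_2 :=
  row i (vec_mx (lsubmx x)).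

Definition radius (R : realType) (n : nat) (x : 'rV[R]_(n * 2 + n))
    (i : 'I_n) : R :=
  rsubmx x 0 i.

Definition disk_packing (R : realType) (n : nat)
    (x : 'rV[R]_(n * 2 + n)) : Prop :=
  (forall i, 0 < radius x i) /\
  (forall i j, i != j ->
     (disk (center x i) (radius x i))° `&`
     (disk (center x j) (radius x j))° = set0).

Definition packings_with_contact_graph (R : realType) (n : nat)
    (G : rel 'I_n) : set 'rV[R]_(n * 2 + n) :=
  [set x | disk_packing x /\
     forall i j, i != j ->
       let d := euclidean_norm (center x i - center x j) in
       if G i j then d = radius x i + radius x j
       else radius x i + radius x j < d].

Definition edges (n : nat) (G : rel 'I_n) : {set {set 'I_n}} :=
  [set [set ij.1; ij.2] | ij : 'I_n * 'I_n & G ij.1 ij.2]%SET.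

(* Main.v *)
From HB Require Import structures.
Require Import Defs.
From mathcomp Require Import all_boot all_order all_algebra.
From mathcomp Require Import all_classical all_reals all_analysis.
From mathcomp Require Import zify ring lra.
Import Defs.

Set Implicit Arguments.
Unset Strict Implicit.
Unset Printing Implicit Defensive.
Import Order.TTheory GRing.Theory Num.Theory.
Import numFieldNormedType.Exports.
Local Open Scope classical_set_scope.
Local Open Scope ring_scope.

(** Around a packing [x] with contact graph [G], the other packings with contact
    graph [G] are the common zeros of the [m] quadratic forms
      [|p_i - p_j|^2 - (r_i + r_j)^2],   [ij] an edge of [G],
    because positivity of the radii and the strict inequalities for the pairs
    that are not in contact persist near [x]. Two facts are needed: the gradients
    of these forms at [x] are linearly independent, and the regular common zeros
    of quadratic forms are a submanifold.

    Independence of the gradients ([contact_stress_trivial]). A linear relation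
    between them is a symmetric stress [w], supported on the edges, with
    [sum_j w_ij (p_i - p_j) = 0] and [sum_j w_ij (r_i + r_j) = 0] at each [i]. As
    [|p_i - p_j| = r_i + r_j] on the edges, the numbers [w_ij |p_i - p_j|] give a
    combination of unit vectors around [i] that annihilates the three functions
    [1, x, y] on the circle. If [i] carries a nonzero stress, the signs of the
    nonzero stresses met when turning around [i] therefore change at least four
    times, and at least three times along the edges when these all lie on one
    side of a line through [i] (Descartes' rule of signs, after a
    stereographic projection: [three_sign_changes], [vertex_sign_changes]). On
    the other hand the edges are segments between centres of touching disks, and
    therefore do not cross ([contact_segments_disjoint]). Such a sign pattern on
    the edges of a plane drawing is impossible. For triangulations this is the
    counting of Cauchy's rigidity theorem; here the count is done without faces
    nor Euler's formula, by sweeping the plane with a horizontal line. The line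
    meets the edges in a certain order; a gap between two neighbours of opposite
    signs counts [-1] as long as both still have their common lower endpoint, and
    [+1] otherwise. Passing a vertex never increases the total ([sweep_step],
    [sweep_vertex]), the lowest vertex with a nonzero stress decreases it, and
    yet it is [0] before and after the sweep, when no edge is met.

    The submanifold ([smooth_submanifold_quadratic_level_set]). Completing the
    gradients at [x] by linear forms gives a quadratic map [phi] of the whole
    space to itself, with invertible derivative at [x], that sends the zero set
    into a coordinate subspace. A quadratic map satisfies an exact mean value
    identity [phi y - phi x = (y - x) S], where [S] is (in row vector convention)
    the derivative at the midpoint and is affine in [x + y]
    ([quad_mapB]). So [phi] is injective where these secants are invertible; it
    is locally onto by Banach's fixed point theorem
    ([quad_map_locally_onto]); and the difference quotients of its inverse are
    given by the inverses of the secants, so that the partial derivatives of the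
    inverse are rational functions of the inverse itself
    ([local_inverse_is_derive]). By induction the inverse is of class [C^k] for
    every [k] ([local_inverse_class]). *)

(** * Sums over consecutive pairs of a list, and sign changes *)

Section AdjacentSums.
Variables (T : Type) (f : T -> T -> int).

Fixpoint adjsum_from x s : int :=
  if s is y :: s' then f x y + adjsum_from y s' else 0.

Definition adjsum s : int := if s is x :: s' then adjsum_from x s' else 0.

Definition junction s1 s2 : int :=
  if (s1, s2) is (x :: s1', y :: _) then f (last x s1') y else 0.

Lemma adjsum_from_cat x s1 s2 :
  adjsum_from x (s1 ++ s2) = adjsum_from x s1 + junction (x :: s1) s2 + adjsum s2.
Proof.
elim: s1 x => [|y s1 IH] x; first by case: s2 => [|z s2]; rewrite /junction /=; ring.
by rewrite /= IH /=; case: s2 {IH} => [|z s2] /=; ring.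
Qed.

Lemma adjsum_cat s1 s2 :
  adjsum (s1 ++ s2) = adjsum s1 + junction s1 s2 + adjsum s2.
Proof. by case: s1 => [|x s1]; [rewrite /junction /= !add0r | exact: adjsum_from_cat]. Qed.

End AdjacentSums.

Section SignChanges.
Variables (T : Type) (b : T -> bool).

Definition sign_change x y : int := (b x != b y)%:Z.

Lemma adjsum_rev s : adjsum sign_change (rev s) = adjsum sign_change s.
Proof.
elim: s => [//|x s IH]; rewrite rev_cons -cats1 adjsum_cat IH /=.
case: s {IH} => [|y s] /=; first by [].
rewrite rev_cons /junction; case E: (rcons _ _) => [|z t].
  by case: (rev s) E.
have -> : last z t = y by rewrite -[LHS]/(last z (z :: t)) -E last_rcons.
rewrite /sign_change eq_sym; ring.
Qed.

Lemma sign_changes_ge0 x s : 0 <= adjsum_from sign_change x s.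
Proof.
by elim: s x => //= y s IH x; apply: addr_ge0; rewrite // /sign_change; case: (_ != _).
Qed.

(** Around a vertex the edges are ordered cyclically, while lists are linear: the
    parity gives the missing change between the last and the first element. *)
Lemma sign_changes_parity x s :
  exists k : int, adjsum_from sign_change x s = sign_change x (last x s) + 2 * k.
Proof.
elim: s x => [|y s IH] x /=; first by exists 0; rewrite /sign_change eqxx; lia.
have [k ->] := IH y; rewrite /sign_change.
by case: (b x) (b y) (b (last y s)) => [] [] [] /=;
  first [by exists k; lia | by exists (k + 1); lia].
Qed.

End SignChanges.

(** * The weight of the gaps along the sweep line *)

Section SweepStep.
Variables (T : eqType) (b : T -> bool) (fresh : rel T).

(** [fresh x y] is to be read: the edges [x] and [y] have the same lower endpoint.
    Between two vertices of a triangulation, the gap between consecutive edges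
    met by the line is a triangle, and it is fresh until its middle vertex is
    passed. *)
Definition gap_weight x y : int :=
  if b x == b y then 0 else if fresh x y then -1 else 1.

Lemma adjsum_gap_old s : {in s &, forall x y, fresh x y -> b x = b y} ->
  adjsum gap_weight s = adjsum (sign_change b) s.
Proof.
case: s => [//|x s] /=; elim: s x => [//|y s IH] x old /=.
rewrite IH; last by move=> u v us vs; apply: old; rewrite inE ?us ?vs orbT.
congr (_ + _); rewrite /gap_weight /sign_change; case: eqP => //= nb.
by case: ifP => // /old nb'; case: nb; apply: nb'; rewrite !inE eqxx ?orbT.
Qed.

Lemma adjsum_gap_fresh s : {in s &, forall x y, fresh x y} ->
  adjsum gap_weight s = - adjsum (sign_change b) s.
Proof.
case: s => [//|x s] /=; elim: s x => [//|y s IH] x fr /=.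
rewrite IH; last by move=> u v us vs; apply: fr; rewrite inE ?us ?vs orbT.
by rewrite /gap_weight /sign_change fr ?inE ?eqxx ?orbT //; case: eqP => /=; lia.
Qed.

Lemma gap_weight_old x y : ~~ fresh x y -> gap_weight x y = sign_change b x y.
Proof. by rewrite /gap_weight /sign_change => /negPf->; case: eqP. Qed.

Lemma gap_weight_bound x y :
  - sign_change b x y <= gap_weight x y <= sign_change b x y.
Proof. by rewrite /gap_weight /sign_change; case: eqP => //; case: ifP. Qed.

(** Passing a vertex replaces the edges [d] that end there by the edges [u] that
    start there, between the edges [L] on its left and [R] on its right. The gaps
    inside [d] disappear and those inside [u] appear, with opposite weights; the
    two gaps at the sides lose their freshness. With [d] and [u] both nonempty,
    their changes are at most [2] minus the sign change between the neighbouring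
    elements of [d] and [u], so the variation is at most [4] minus the number of
    sign changes around the vertex. When [d] or [u] is empty, the three gaps
    created or destroyed at the sides have a total weight at most [3]. *)
Lemma sweep_step (L d u R : seq T) :
  {in d &, forall x y, fresh x y -> b x = b y} ->
  {in u &, forall x y, fresh x y} ->
  {in L & u, forall x y, ~~ fresh x y} ->
  {in u & R, forall x y, ~~ fresh x y} ->
  d ++ u = [::] \/ 3 <= adjsum (sign_change b) (d ++ rev u) ->
  adjsum gap_weight (L ++ u ++ R) <= adjsum gap_weight (L ++ d ++ R).
Proof.
move=> old fr Lu uR [/eqP|].
  by rewrite -size_eq0 size_cat addn_eq0 !size_eq0 => /andP[/eqP-> /eqP->].
rewrite !adjsum_cat adjsum_rev (adjsum_gap_old old) (adjsum_gap_fresh fr).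
have wLu y u' : u = y :: u' -> forall l L', L = l :: L' ->
    gap_weight (last l L') y = sign_change b (last l L') y.
  by move=> eu l L' eL; apply/gap_weight_old/Lu;
     rewrite ?eu ?eL ?mem_last ?inE ?eqxx.
have wuR y u' : u = y :: u' -> forall r R', R = r :: R' ->
    gap_weight (last y u') r = sign_change b (last y u') r.
  by move=> eu r R' eR; apply/gap_weight_old/uR;
     rewrite ?eu ?eR ?mem_last ?inE ?eqxx.
case: d {old} => [|x d]; case: u {Lu uR fr} wLu wuR => [|y u] wLu wuR //=.
- have [k] := sign_changes_parity b y u.
  move: (adjsum_from (sign_change b) y u) => su ek.
  case: L wLu => [|l L] wLu; case: R wuR => [|r R] wuR; rewrite /junction /=;
  rewrite ?(wLu _ _ erefl _ _ erefl) ?(wuR _ _ erefl _ _ erefl); move: ek;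
  try (have := gap_weight_bound (last l L) r); rewrite /sign_change; lia.
- have [k] := sign_changes_parity b x d.
  move: (adjsum_from (sign_change b) x d) => sd ek.
  case: L {wLu} => [|l L]; case: R {wuR} => [|r R]; rewrite /junction /=; move: ek;
  try (have := gap_weight_bound (last l L) r);
  try (have := gap_weight_bound (last l L) x);
  try (have := gap_weight_bound (last x d) r);
  rewrite /sign_change; lia.
have -> : junction (sign_change b) (x :: d) (rev (y :: u))
   = sign_change b (last x d) (last y u).
  by rewrite [y :: u]lastI rev_rcons.
have [k] := sign_changes_parity b y u.
have [k'] := sign_changes_parity b x d.
move: (adjsum_from (sign_change b) y u) => su.
move: (adjsum_from (sign_change b) x d) => sd ek ek'.
case: L wLu => [|l L] wLu; case: R wuR => [|r R] wuR; rewrite /junction /=;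
  rewrite ?(wLu _ _ erefl _ _ erefl) ?(wuR _ _ erefl _ _ erefl); move: ek ek';
  try (have := gap_weight_bound (last l L) x);
  try (have := gap_weight_bound (last x d) r);
  rewrite /sign_change; lia.
Qed.

End SweepStep.

(** * Sign changes forced by vanishing moments *)

Section Descartes.
Variables (R : realFieldType) (T : eqType) (t mu : T -> R).

(** Each sign change is matched by a root placed between the two abscissas. The
    sign is controlled on the whole half-line to the left of the first abscissa,
    where the root of the next step of the induction is added. *)
Lemma sign_change_poly x s :
  pairwise (fun x y => t x < t y) (x :: s) -> {in x :: s, forall y, mu y != 0} ->
  exists2 P : {poly R},
    (size P <= `|adjsum_from (sign_change (fun y => (0 < mu y)%R)) x s|.+1)%N &
    (forall c, c <= t x -> 0 < mu x * P.[c]) /\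
    {in x :: s, forall y, 0 < mu y * P.[t y]}.
Proof.
elim: s x => [|y s IH] x.
  move=> _ nz; have mx : mu x != 0 by apply: nz; rewrite inE.
  exists (mu x)%:P => /=; first by rewrite size_polyC mx.
  by split=> [c _|y /[!inE] /eqP->]; rewrite hornerC -expr2 lt0r sqr_ge0 sqrf_eq0 mx.
rewrite pairwise_cons => /andP[/allP xs ys] nz.
have nz' : {in y :: s, forall y, mu y != 0}.
  by move=> z zs; apply: nz; rewrite inE zs orbT.
have [P sP [Pl Ps]] := IH y ys nz'.
have txy : t x < t y by apply: xs; rewrite inE eqxx.
have mx : mu x != 0 by apply: nz; rewrite inE eqxx.
have my : mu y != 0 by apply: nz; rewrite !inE eqxx orbT.
have [same|diff] := eqVneq (0 < mu x) (0 < mu y).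
  exists P; first by rewrite /= /sign_change same eqxx add0r.
  have xl c : c <= t x -> 0 < mu x * P.[c].
    move=> cx; have := Pl c (le_trans cx (ltW txy)).
    move: same; case: (ltgtP 0 (mu y)) my => // my _; case: (ltgtP 0 (mu x)) mx => // mx _ _.
      by rewrite !pmulr_rgt0.
    by rewrite !nmulr_rgt0.
  split=> // z; rewrite inE => /predU1P[->|]; [exact: xl|exact: Ps].
pose c0 := (t x + t y) / 2.
have [xc cy] : t x < c0 /\ c0 < t y by rewrite /c0; split; lra.
exists (P * ('X - c0%:P)).
  rewrite (leq_trans (size_polyMleq _ _)) // size_XsubC /= {1}/sign_change diff.
  move: sP (sign_changes_ge0 (fun y => 0 < mu y) y s).
  move: (adjsum_from _ _ _) (size P) => a sP; rewrite -[X in (_ + X)%N]/2%N /=.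
  by lia.
have xl c : c <= t x -> 0 < mu x * (P * ('X - c0%:P)).[c].
  move=> cx; have := Pl c (le_trans cx (ltW txy)); rewrite hornerM hornerXsubC.
  have c_lt : c - c0 < 0 by lra.
  move: diff; case: (ltgtP 0 (mu y)) my => // my _; case: (ltgtP 0 (mu x)) mx => // mx _ _.
    by rewrite pmulr_rgt0 // nmulr_rgt0 // => P0; rewrite nmulr_llt0.
  by rewrite nmulr_rgt0 // pmulr_rgt0 // => P0; rewrite nmulr_lgt0.
split=> // z; rewrite inE => /predU1P[->|zs]; first exact: xl.
rewrite hornerM hornerXsubC mulrA pmulr_lgt0; first exact: Ps.
rewrite subr_gt0 (lt_le_trans cy) //.
move: zs; rewrite inE => /predU1P[->//|zs].
by move: ys => /= /andP[/allP/(_ z zs)/ltW].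
Qed.

(** With fewer changes, the polynomial of [sign_change_poly] has degree at most 2,
    and its sum against [mu] is both [0] and positive. *)
Lemma three_sign_changes s : s != [::] ->
  pairwise (fun x y => t x < t y) s -> {in s, forall y, mu y != 0} ->
  (forall k, (k < 3)%N -> \sum_(x <- s) mu x * t x ^+ k = 0) ->
  3 <= adjsum (sign_change (fun y => (0 < mu y)%R)) s.
Proof.
case: s => // x s _ ord nz mom /=.
have [P sP [_ Ps]] := sign_change_poly ord nz.
set a := adjsum_from _ _ _ in sP *.
have a0 : 0 <= a by exact: sign_changes_ge0.
rewrite leNgt; apply/negP => a3.
have sP3 : (size P <= 3)%N by lia.
have : \sum_(y <- x :: s) mu y * P.[t y] = 0.
  under eq_bigr => y _ do rewrite (horner_coef_wide _ sP3) mulr_sumr.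
  rewrite exchange_big big1 // => i _ /=.
  under eq_bigr => y _ do rewrite mulrCA.
  by rewrite -mulr_sumr mom // mulr0.
rewrite big_cons => sum0.
have : 0 < mu x * P.[t x] by apply: Ps; rewrite inE eqxx.
have : 0 <= \sum_(y <- s) mu y * P.[t y].
  rewrite big_seq; apply: sumr_ge0 => y ys; apply/ltW/Ps.
  by rewrite inE ys orbT.
lra.
Qed.

End Descartes.

(** * Segments joining the centres of touching disks *)

Section DiskGeometry.
Variable R : realFieldType.
Implicit Types (s t : R).

(** Here [a], [b], [c], [d] are the distances from a crossing point of two segments
    to their endpoints, which are the centres of disks of radii [ra], [rb] and
    [rc], [rd]. The last two inequalities must be equalities, so [a - ra] and
    [c - rc] are equal, and opposite to [b - rb] and [d - rd]; whichever of these
    is nonpositive contradicts one of the first two inequalities. *)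
Lemma crossing_lengths (a b c d ra rb rc rd : R) :
  0 <= a -> 0 <= b -> 0 <= c -> 0 <= d ->
  0 < ra -> 0 < rb -> 0 < rc -> 0 < rd ->
  a + b = ra + rb -> c + d = rc + rd ->
  (ra + rc) ^+ 2 <= a ^+ 2 + c ^+ 2 -> (rb + rd) ^+ 2 <= b ^+ 2 + d ^+ 2 ->
  (ra + rd) ^+ 2 <= (a + d) ^+ 2 -> (rb + rc) ^+ 2 <= (b + c) ^+ 2 -> False.
Proof.
move=> a0 b0 c0 d0 ra0 rb0 rc0 rd0 eab ecd hac hbd.
rewrite !ler_sqr ?nnegrE ?addr_ge0 ?(ltW ra0) ?(ltW rb0) ?(ltW rc0) ?(ltW rd0) //.
move=> had hbc.
have [ale|alt] := lerP a ra.
  have cle : c <= rc by lra.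
  have : a ^+ 2 <= ra ^+ 2 by rewrite ler_sqr ?nnegrE // ltW.
  have : c ^+ 2 <= rc ^+ 2 by rewrite ler_sqr ?nnegrE // ltW.
  have := mulr_gt0 ra0 rc0; nra.
have : b ^+ 2 <= rb ^+ 2 by rewrite ler_sqr ?nnegrE //; lra.
have : d ^+ 2 <= rd ^+ 2 by rewrite ler_sqr ?nnegrE //; lra.
have := mulr_gt0 rb0 rd0; nra.
Qed.

(** If the two directions make an acute angle, two of the four distances between
    endpoints of different segments are at most hypotenuses; the other two are at
    most sums by the triangle inequality. An obtuse angle amounts to exchanging
    the endpoints of the second segment. *)
Lemma contact_segments_disjoint (xa ya xb yb xc yc xd yd ra rb rc rd s t : R) :
  0 < ra -> 0 < rb -> 0 < rc -> 0 < rd ->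
  0 <= s <= 1 -> 0 <= t <= 1 ->
  xa + s * (xb - xa) = xc + t * (xd - xc) ->
  ya + s * (yb - ya) = yc + t * (yd - yc) ->
  (xa - xb) ^+ 2 + (ya - yb) ^+ 2 = (ra + rb) ^+ 2 ->
  (xc - xd) ^+ 2 + (yc - yd) ^+ 2 = (rc + rd) ^+ 2 ->
  (ra + rc) ^+ 2 <= (xa - xc) ^+ 2 + (ya - yc) ^+ 2 ->
  (ra + rd) ^+ 2 <= (xa - xd) ^+ 2 + (ya - yd) ^+ 2 ->
  (rb + rc) ^+ 2 <= (xb - xc) ^+ 2 + (yb - yc) ^+ 2 ->
  (rb + rd) ^+ 2 <= (xb - xd) ^+ 2 + (yb - yd) ^+ 2 -> False.
Proof.
move=> ra0 rb0 rc0 rd0 /andP[s0 s1] /andP[t0 t1] ex ey.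
pose ex1 := xb - xa; pose ey1 := yb - ya; pose fx := xd - xc; pose fy := yd - yc.
have -> : xb = xa + ex1 by rewrite /ex1; ring.
have -> : yb = ya + ey1 by rewrite /ey1; ring.
have -> : xd = xc + fx by rewrite /fx; ring.
have -> : yd = yc + fy by rewrite /fy; ring.
have {ex}-> : xa = xc + t * fx - s * ex1 by rewrite /fx /ex1; lra.
have {ey}-> : ya = yc + t * fy - s * ey1 by rewrite /fy /ey1; lra.
move: ex1 ey1 fx fy => ex ey fx fy.
set l := ra + rb; set m := rc + rd => el em.
have {}el : ex ^+ 2 + ey ^+ 2 = l ^+ 2 by rewrite -el; ring.
have {}em : fx ^+ 2 + fy ^+ 2 = m ^+ 2 by rewrite -em; ring.
have l0 : 0 < l by rewrite addr_gt0.
have m0 : 0 < m by rewrite addr_gt0.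
pose K := ex * fx + ey * fy.
have K2 : K ^+ 2 <= (l * m) ^+ 2.
  rewrite exprMn -el -em -subr_ge0.
  have -> : (ex ^+ 2 + ey ^+ 2) * (fx ^+ 2 + fy ^+ 2) - K ^+ 2
    = (ex * fy - ey * fx) ^+ 2 by rewrite /K; ring.
  exact: sqr_ge0.
have lm0 : 0 < l * m by rewrite mulr_gt0.
have [Kle Kge] : - (l * m) <= K /\ K <= l * m.
  by apply/andP; rewrite -ler_norml -ler_sqr ?nnegrE ?normr_ge0 ?(ltW lm0) // real_normK ?num_real.
have s'0 : 0 <= 1 - s by lra.
have t'0 : 0 <= 1 - t by lra.
have := mulr_ge0 s0 t0; have := mulr_ge0 s0 t'0.
have := mulr_ge0 s'0 t0; have := mulr_ge0 s'0 t'0.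
set s' := 1 - s in s'0 *; set t' := 1 - t in t'0 *.
move=> st1 st2 st3 st4 hac had hbc hbd.
have {}hac : (ra + rc) ^+ 2 <= (s * l) ^+ 2 + (t * m) ^+ 2 - 2 * (s * t) * K.
  by rewrite (le_trans hac) // le_eqVlt; apply/orP; left; rewrite !exprMn -el -em /K; apply/eqP; ring.
have {}had : (ra + rd) ^+ 2 <= (s * l) ^+ 2 + (t' * m) ^+ 2 + 2 * (s * t') * K.
  by rewrite (le_trans had) // le_eqVlt; apply/orP; left; rewrite !exprMn -el -em /K /t'; apply/eqP; ring.
have {}hbc : (rb + rc) ^+ 2 <= (s' * l) ^+ 2 + (t * m) ^+ 2 + 2 * (s' * t) * K.
  by rewrite (le_trans hbc) // le_eqVlt; apply/orP; left; rewrite !exprMn -el -em /K /s'; apply/eqP; ring.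
have {}hbd : (rb + rd) ^+ 2 <= (s' * l) ^+ 2 + (t' * m) ^+ 2 - 2 * (s' * t') * K.
  by rewrite (le_trans hbd) // le_eqVlt; apply/orP; left; rewrite !exprMn -el -em /K /s' /t'; apply/eqP; ring.
have e1 : s * l + s' * l = ra + rb by rewrite /s' /l; ring.
have e2 : t * m + t' * m = rc + rd by rewrite /t' /m; ring.
(* [K] is the inner product of the direction vectors of the segments. *)
have [K0|K0] := leP 0 K.
  apply: (@crossing_lengths (s * l) (s' * l) (t * m) (t' * m) ra rb rc rd) => //;
    rewrite ?mulr_ge0 ?(ltW l0) ?(ltW m0) //.
  - have := mulr_ge0 st4 K0; lra.
  - have := mulr_ge0 st1 K0; lra.
  - have := ler_wpM2l st3 Kge; lra.
  - have := ler_wpM2l st2 Kge; lra.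
have nK0 : 0 <= - K by lra.
have nK : - K <= l * m by lra.
apply: (@crossing_lengths (s * l) (s' * l) (t' * m) (t * m) ra rb rd rc) => //;
    rewrite ?mulr_ge0 ?(ltW l0) ?(ltW m0) //.
- by rewrite addrC e2 addrC.
- have := mulr_ge0 st3 nK0; lra.
- have := mulr_ge0 st2 nK0; lra.
- have := ler_wpM2l st4 nK; lra.
- have := ler_wpM2l st1 nK; lra.
Qed.

(** Two disks touching a third one in the same direction overlap. *)
Lemma contact_directions (ux uy vx vy ra rb rc k : R) : 
  0 < ra -> 0 < rb -> 0 < rc -> 0 < k ->
  ux = k * vx -> uy = k * vy ->
  ux ^+ 2 + uy ^+ 2 = (ra + rb) ^+ 2 ->
  vx ^+ 2 + vy ^+ 2 = (ra + rc) ^+ 2 ->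
  (rb + rc) ^+ 2 <= (ux - vx) ^+ 2 + (uy - vy) ^+ 2 -> False.
Proof.
move=> ra0 rb0 rc0 k0 -> -> eb ec.
have : (ra + rb) ^+ 2 = (k * (ra + rc)) ^+ 2 by rewrite -eb [RHS]exprMn -ec; ring.
have l0 : 0 <= ra + rb by rewrite addr_ge0 // ltW.
have l0' : 0 <= k * (ra + rc) by rewrite mulr_ge0 ?addr_ge0 // ltW.
move/eqP; rewrite eqrXn2 // => /eqP ek.
have -> : (k * vx - vx) ^+ 2 + (k * vy - vy) ^+ 2 = (rb - rc) ^+ 2.
  have -> : rb - rc = (k - 1) * (ra + rc) by rewrite mulrBl mul1r -ek; ring.
  by rewrite exprMn -ec; ring.
have := mulr_gt0 rb0 rc0; nra.
Qed.

Lemma vertex_off_segment (xa ya xb yb x y ra rb r s : R) : 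
  0 < ra -> 0 < rb -> 0 < r -> 0 <= s <= 1 ->
  x = xa + s * (xb - xa) -> y = ya + s * (yb - ya) ->
  (xa - xb) ^+ 2 + (ya - yb) ^+ 2 = (ra + rb) ^+ 2 ->
  (ra + r) ^+ 2 <= (xa - x) ^+ 2 + (ya - y) ^+ 2 ->
  (rb + r) ^+ 2 <= (xb - x) ^+ 2 + (yb - y) ^+ 2 -> False.
Proof.
move=> ra0 rb0 r0 /andP[s0 s1] -> -> el ha hb.
have l0 : 0 < ra + rb by rewrite addr_gt0.
have : (ra + r) ^+ 2 <= (s * (ra + rb)) ^+ 2.
  by rewrite exprMn -el (le_trans ha) // le_eqVlt; apply/orP; left; apply/eqP; ring.
have : (rb + r) ^+ 2 <= ((1 - s) * (ra + rb)) ^+ 2.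
  by rewrite exprMn -el (le_trans hb) // le_eqVlt; apply/orP; left; apply/eqP; ring.
have [l0' ra0' rb0' r0'] : [/\ 0 <= ra + rb, 0 <= ra, 0 <= rb & 0 <= r].
  by split; apply: ltW.
rewrite !ler_sqr ?nnegrE ?mulr_ge0 ?subr_ge0 ?addr_ge0 //; lra.
Qed.

End DiskGeometry.

Lemma pairwise_le_split (R : realFieldType) (T : eqType) (key : T -> R) c s :
  pairwise (fun x y => key x <= key y) s ->
  s = [seq x <- s | key x < c] ++ [seq x <- s | key x == c]
      ++ [seq x <- s | c < key x].
Proof.
elim: s => [//|x s IH]; rewrite pairwise_cons => /andP[/allP xs /IH{IH} IH] /=.
case: (ltgtP (key x) c) => [xc|cx|xc] /=; first by rewrite -IH.
- have s_gt : all (fun y => c < key y) s.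
    by apply/allP => y /xs xy; rewrite (lt_le_trans cx).
  have nil (P : pred T) : {in s, forall y, ~~ P y} -> [seq y <- s | P y] = [::].
    by move=> nP; apply/eqP; rewrite -[_ == _]negbK -has_filter; apply/hasPn.
  rewrite (nil (fun y => key y < c)) ?(nil (fun y => key y == c)) /=.
  + by move/all_filterP: s_gt => ->.
  + by move=> y /(allP s_gt) cy; rewrite gt_eqF.
  + by move=> y /(allP s_gt) cy; rewrite -leNgt ltW.
have nil : [seq y <- s | key y < c] = [::].
  apply/eqP; rewrite -[_ == _]negbK -has_filter; apply/hasPn => y /xs.
  by rewrite xc -leNgt.
by move: IH; rewrite nil /= => {1}->.
Qed.

(** * The sweep *)

Section Sweep.
Variables (R : realFieldType) (V : finType) (px py r : V -> R) (w : V -> V -> R).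
Hypothesis r_gt0 : forall i, 0 < r i.
Hypothesis disjoint_disks : forall i j, i != j ->
  (r i + r j) ^+ 2 <= (px i - px j) ^+ 2 + (py i - py j) ^+ 2.
Hypothesis w_sym : forall i j, w i j = w j i.
Hypothesis contact : forall i j, w i j != 0 -> i != j /\
  (px i - px j) ^+ 2 + (py i - py j) ^+ 2 = (r i + r j) ^+ 2.
Hypothesis eq_x : forall i, \sum_j w i j * (px i - px j) = 0.
Hypothesis eq_y : forall i, \sum_j w i j * (py i - py j) = 0.
Hypothesis eq_r : forall i, \sum_j w i j * (r i + r j) = 0.
(** No two centres lie at the same height, so the sweep line meets them one by one
    and no edge is horizontal. *)
Hypothesis py_inj : injective py.

Implicit Types (e f : V * V) (h : R).

Definition upward_edge e := (w e.1 e.2 != 0) && (py e.1 < py e.2).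

(** Edges are parametrized by the height, as the sweep line is horizontal. *)
Definition inv_slope e := (px e.2 - px e.1) / (py e.2 - py e.1).

Definition abscissa e h := px e.1 + (h - py e.1) * inv_slope e.

Lemma abscissa_bottom e : abscissa e (py e.1) = px e.1.
Proof. by rewrite /abscissa; ring. Qed.

Lemma inv_slopeK e : upward_edge e ->
  inv_slope e * (py e.2 - py e.1) = px e.2 - px e.1.
Proof. by case/andP=> _ lt12; rewrite /inv_slope divfK // subr_eq0 gt_eqF. Qed.

Lemma abscissa_topE e h : upward_edge e ->
  abscissa e h = px e.2 + (h - py e.2) * inv_slope e.
Proof. by move=> /inv_slopeK E; rewrite /abscissa -(subrK (px e.1) (px e.2)) -E; ring. Qed.

Lemma abscissa_top e : upward_edge e -> abscissa e (py e.2) = px e.2.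
Proof. by move=> ee; rewrite abscissa_topE //; ring. Qed.

Lemma abscissa_param e h : upward_edge e -> py e.1 <= h <= py e.2 ->
  exists2 s, 0 <= s <= 1 & abscissa e h = px e.1 + s * (px e.2 - px e.1) /\
                           h = py e.1 + s * (py e.2 - py e.1).
Proof.
move=> ee /andP[h1 h2]; have /andP[_ lt12] := ee.
have d0 : 0 < py e.2 - py e.1 by rewrite subr_gt0.
exists ((h - py e.1) / (py e.2 - py e.1)); last first.
  rewrite /abscissa /inv_slope divfK ?gt_eqF //; split; last by ring.
  by rewrite mulrA mulrAC.
by rewrite divr_ge0 ?subr_ge0 ?(ltW lt12) //= ler_pdivrMr // mul1r lerD2r.
Qed.

Lemma noncrossing e f h : upward_edge e -> upward_edge f ->
  py e.1 < h < py e.2 -> py f.1 < h < py f.2 ->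
  abscissa e h = abscissa f h -> e = f.
Proof.
move=> ee ef /andP[e1h he2] /andP[f1h hf2] eX.
have [/contact[ne12 ce] lte] := andP ee; have [/contact[nf12 cf] ltf] := andP ef.
have [e11|n11] := eqVneq e.1 f.1.
  have [e22|n22] := eqVneq e.2 f.2; first by rewrite [e]surjective_pairing e11 e22 -surjective_pairing.
  have sl : inv_slope e = inv_slope f.
    move: eX; rewrite /abscissa e11 => /addrI/mulfI; apply.
    by rewrite subr_eq0 gt_eqF.
  exfalso; apply: (@contact_directions _ (px e.2 - px e.1) (py e.2 - py e.1)
    (px f.2 - px f.1) (py f.2 - py f.1) (r e.1) (r e.2) (r f.2)
    ((py e.2 - py e.1) / (py f.2 - py f.1))) => //.
  - by rewrite divr_gt0 ?subr_gt0.
  - by rewrite -(inv_slopeK ee) -(inv_slopeK ef) sl; field; rewrite subr_eq0 gt_eqF.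
  - by rewrite divfK // subr_eq0 gt_eqF.
  - by rewrite -ce; ring.
  - by rewrite e11 -cf; ring.
  - by rewrite (le_trans (disjoint_disks n22)) // e11 le_eqVlt; apply/orP; left; apply/eqP; ring.
have [e22|n22] := eqVneq e.2 f.2.
  have sl : inv_slope e = inv_slope f.
    move: eX; rewrite !abscissa_topE // e22 => /addrI/mulfI; apply.
    by rewrite subr_eq0 lt_eqF.
  exfalso; apply: (@contact_directions _ (px e.1 - px e.2) (py e.1 - py e.2)
    (px f.1 - px f.2) (py f.1 - py f.2) (r e.2) (r e.1) (r f.1)
    ((py e.2 - py e.1) / (py f.2 - py f.1))) => //.
  - by rewrite divr_gt0 ?subr_gt0.
  - rewrite -[LHS]opprB -(inv_slopeK ee) -[px f.1 - _]opprB -(inv_slopeK ef) sl.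
    by field; rewrite subr_eq0 gt_eqF.
  - by rewrite -[py f.1 - _]opprB mulrN divfK ?opprB // subr_eq0 gt_eqF.
  - by rewrite ce addrC.
  - by rewrite e22 cf addrC.
  - by rewrite (le_trans (disjoint_disks n11)) // e22 le_eqVlt; apply/orP; left; apply/eqP; ring.
have n12 : e.1 != f.2.
  by apply/eqP => E; have := lt_trans e1h hf2; rewrite E ltxx.
have n21 : e.2 != f.1.
  by apply/eqP => E; have := lt_trans f1h he2; rewrite E ltxx.
have [s s01 [sx sy]] := abscissa_param ee (introT andP (conj (ltW e1h) (ltW he2))).
have [t t01 [tx ty]] := abscissa_param ef (introT andP (conj (ltW f1h) (ltW hf2))).
exfalso; apply: (contact_segments_disjoint (r_gt0 e.1) (r_gt0 e.2) (r_gt0 f.1)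
  (r_gt0 f.2) s01 t01 _ _ ce cf); rewrite ?disjoint_disks //.
- by rewrite -sx -tx.
- by rewrite -sy -ty.
Qed.

(** The difference of the abscissas of two edges is affine in the height; if it
    changed sign, the edges would cross. The height [h0] may be an endpoint,
    while [h1] is interior. *)
Lemma same_side e f h0 h1 : upward_edge e -> upward_edge f ->
  py e.1 <= h0 <= py e.2 -> py f.1 <= h0 <= py f.2 ->
  py e.1 < h1 < py e.2 -> py f.1 < h1 < py f.2 ->
  abscissa e h0 < abscissa f h0 -> abscissa e h1 < abscissa f h1.
Proof.
move=> ee ef /andP[e1 e2] /andP[f1 f2] /andP[e1' e2'] /andP[f1' f2'] lt0.
rewrite ltNge; apply/negP => le1.
pose g h := abscissa f h - abscissa e h.
have gE h : g h = g h0 + (h - h0) * (inv_slope f - inv_slope e).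
  by rewrite /g /abscissa; ring.
have g0 : 0 < g h0 by rewrite subr_gt0.
have g1 : g h1 <= 0 by rewrite subr_le0.
have gd : 0 < g h0 - g h1 by lra.
pose th := g h0 / (g h0 - g h1).
have th0 : 0 < th by rewrite divr_gt0.
have th1 : 0 <= 1 - th by rewrite subr_ge0 ler_pdivrMr // mul1r; lra.
have thE : th * (g h0 - g h1) = g h0 by rewrite divfK ?gt_eqF.
pose h := (1 - th) * h0 + th * h1.
have gh : g h = 0.
  move: thE; rewrite (gE h) (gE h1) /h => thE.
  rewrite -[X in X + _]thE; ring.
have inside a : a <= h0 -> a < h1 -> a < h.
  move=> a0 a1; rewrite -subr_gt0.
  have -> : h - a = (1 - th) * (h0 - a) + th * (h1 - a) by rewrite /h; ring.
  by apply: ltr_wpDl; [rewrite mulr_ge0 // subr_ge0|rewrite mulr_gt0 // subr_gt0].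
have inside' a : h0 <= a -> h1 < a -> h < a.
  move=> a0 a1; rewrite -subr_gt0.
  have -> : a - h = (1 - th) * (a - h0) + th * (a - h1) by rewrite /h; ring.
  by apply: ltr_wpDl; [rewrite mulr_ge0 // subr_ge0|rewrite mulr_gt0 // subr_gt0].
have E : e = f.
  by apply: (@noncrossing _ _ h) => //; rewrite ?inside ?inside' //; move/subr0_eq: gh.
by rewrite E ltxx in lt0.
Qed.

Definition mid_height e f :=
  (Num.max (py e.1) (py f.1) + Num.min (py e.2) (py f.2)) / 2.

(** By [same_side] any other common height would do; the choice of one height
    makes the relation boolean. *)
Definition left_of e f :=
  abscissa e (mid_height e f) < abscissa f (mid_height e f).

Definition overlap e f := (py e.1 < py f.2) && (py f.1 < py e.2).

Lemma mid_height_in e f : upward_edge e -> upward_edge f -> overlap e f ->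
  py e.1 < mid_height e f < py e.2 /\ py f.1 < mid_height e f < py f.2.
Proof.
case/andP=> _ ee /andP[_ ef] /andP[ov1 ov2].
rewrite /mid_height; case: (leP (py e.1) (py f.1)) => ?;
  case: (leP (py e.2) (py f.2)) => ?;
  split; apply/andP; split; lra.
Qed.

Lemma left_ofI e f h : upward_edge e -> upward_edge f -> overlap e f ->
  py e.1 <= h <= py e.2 -> py f.1 <= h <= py f.2 ->
  abscissa e h < abscissa f h -> left_of e f.
Proof.
move=> ee ef ov he hf; have [? ?] := mid_height_in ee ef ov.
exact: same_side.
Qed.

Lemma left_of_le e f h : upward_edge e -> upward_edge f -> overlap e f ->
  py e.1 <= h <= py e.2 -> py f.1 <= h <= py f.2 ->
  left_of e f -> abscissa e h <= abscissa f h.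
Proof.
move=> ee ef ov he hf; rewrite /left_of => lef.
have [m1 m2] := mid_height_in ee ef ov; rewrite leNgt; apply/negP => fe.
by have := same_side ef ee hf he m2 m1 fe; rewrite ltNge (ltW lef).
Qed.

Section AtVertex.
Variable v : V.

(** The tangent of half the polar angle of [j] seen from [v], when [v] and [j] are
    in contact. In other words, the stereographic projection, from the point
    [(-1, 0)] of the circle, of the unit vector pointing to [j]. *)
Definition half_tan j := (py j - py v) / (r j + r v + (px j - px v)).

Lemma half_tan_denom j : w v j != 0 -> 0 < r j + r v + (px j - px v).
Proof.
move=> /contact[nvj c]; have D0 : 0 < r v + r j by rewrite addr_gt0.
have ny : 0 < (py v - py j) ^+ 2.
  by rewrite lt0r sqr_ge0 andbT sqrf_eq0 subr_eq0 (inj_eq py_inj).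
rewrite addrC -ltrBlDr sub0r addrC.
have : `|px v - px j| < r v + r j.
  by rewrite -ltr_sqr ?nnegrE ?(ltW D0) // real_normK ?num_real // -c ltrDl.
by rewrite ltr_norml => /andP[_]; lra.
Qed.

(** In the coordinate [t] of the stereographic projection, the functions [1], [x],
    [y] on the circle span [1 / (1 + t^2)] times the polynomials of degree at most
    2. Up to a factor 2, this is the stress times the length times
    [1 / (1 + t^2)]. *)
Definition moment_weight j := w v j * (r j + r v + (px j - px v)).

(** With [l = r_j + r_v] and [(x, y)] the vector from [v] to [j], the relation
    [y^2 = (l + x) (l - x)] turns the terms of order 0, 1, 2 into [w v j] times
    [l + x], [y] and [l - x]. *)
Lemma vertex_moments k : (k < 3)%N -> \sum_j moment_weight j * half_tan j ^+ k = 0.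
Proof.
have sx : \sum_j w v j * (px j - px v) = 0.
  apply: etrans (_ : - (\sum_j w v j * (px v - px j)) = 0).
    by rewrite -sumrN; apply: eq_bigr => j _; ring.
  by rewrite eq_x oppr0.
have sy : \sum_j w v j * (py j - py v) = 0.
  apply: etrans (_ : - (\sum_j w v j * (py v - py j)) = 0).
    by rewrite -sumrN; apply: eq_bigr => j _; ring.
  by rewrite eq_y oppr0.
have sr : \sum_j w v j * (r j + r v) = 0.
  by apply: etrans (eq_r v); apply: eq_bigr => j _; rewrite addrC.
case: k => [|[|[|//]]] _.
- transitivity (\sum_j w v j * (r j + r v) + \sum_j w v j * (px j - px v)).
    by rewrite -big_split /=; apply: eq_bigr => j _; rewrite /moment_weight; ring.
  by rewrite sx sr addr0.
- rewrite -[RHS]sy; apply: eq_bigr => j _; rewrite /moment_weight /half_tan.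
  have [->|nz] := eqVneq (w v j) 0; first by rewrite !mul0r.
  by field; rewrite gt_eqF // half_tan_denom.
- transitivity (\sum_j w v j * (r j + r v) - \sum_j w v j * (px j - px v)).
    rewrite -sumrB; apply: eq_bigr => j _; rewrite /moment_weight /half_tan.
    have [->|nz] := eqVneq (w v j) 0; first by rewrite !mul0r subr0.
    have D0 := half_tan_denom nz; have [_ c] := contact nz.
    rewrite -mulrBr -mulrA; congr (_ * _).
    rewrite expr_div_n; have -> : (py j - py v) ^+ 2 =
      (r j + r v + (px j - px v)) * (r j + r v - (px j - px v)).
      by move: c; rewrite (addrC (r v)) => c; rewrite mulrC -subr_sqr -c; ring.
    by field; rewrite gt_eqF.
  by rewrite sx sr subr0.
Qed.

(** The endpoint other than [v] of an edge at [v]. *)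
Definition far_end e := if e.2 == v then e.1 else e.2.

(** The identity [cot (2 a) = (1 / tan a - tan a) / 2]. *)
Lemma half_tan_slope j : w v j != 0 ->
  (px j - px v) / (py j - py v) = ((half_tan j)^-1 - half_tan j) / 2.
Proof.
move=> nz; have D0 := half_tan_denom nz; have [nvj c] := contact nz.
have ny : py j - py v != 0 by rewrite subr_eq0 (inj_eq py_inj) eq_sym.
rewrite /half_tan invf_div.
have c' : (py j - py v) ^+ 2 =
      (r j + r v + (px j - px v)) * (r j + r v - (px j - px v)).
  by move: c; rewrite (addrC (r v)) => c; rewrite mulrC -subr_sqr -c; ring.
have -> : (py j - py v) / (r j + r v + (px j - px v))
   = (r j + r v - (px j - px v)) / (py j - py v).
  apply: (mulIf ny); rewrite divfK // mulrAC -expr2 c'.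
  by field; rewrite gt_eqF.
by field.
Qed.

Lemma half_tan_gt0 j : w v j != 0 -> (0 < half_tan j) = (py v < py j).
Proof. by move=> /half_tan_denom D0; rewrite pmulr_lgt0 ?invr_gt0 // subr_gt0. Qed.

Lemma half_tan_lt0 j : w v j != 0 -> (half_tan j < 0) = (py j < py v).
Proof. by move=> /half_tan_denom D0; rewrite pmulr_llt0 ?invr_gt0 // subr_lt0. Qed.

(** The cotangent decreases on each of the two half-planes bounded by the
    horizontal line through [v]. *)
Lemma half_tan_mono j k : w v j != 0 -> w v k != 0 ->
  0 < half_tan j * half_tan k ->
  (half_tan j < half_tan k) =
  ((px k - px v) / (py k - py v) < (px j - px v) / (py j - py v)).
Proof.
move=> nj nk; rewrite !half_tan_slope // ltr_pM2r ?invr_gt0 ?ltr0n //.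
move: (half_tan j) (half_tan k) => a b ab.
have mono (x y : R) : 0 < x * y -> x < y -> y^-1 - y < x^-1 - x.
  move=> xy lt; have [nx ny] : x != 0 /\ y != 0.
    by apply/andP; rewrite -negb_or -mulf_eq0 gt_eqF.
  rewrite -subr_gt0.
  have -> : x^-1 - x - (y^-1 - y) = (y - x) * (1 + (x * y)^-1).
    by field; rewrite nx ny.
  by rewrite mulr_gt0 ?subr_gt0 // addr_gt0 ?invr_gt0.
case: (ltgtP a b) => [lt|gt|->]; last by rewrite ltxx.
- by rewrite mono.
- by rewrite ltNge ltW // mono // mulrC.
Qed.

End AtVertex.

Definition positive_stress e := 0 < w e.1 e.2.
Definition same_bottom e f := e.1 == f.1.

Lemma far_end_of_bottom v e : upward_edge e -> e.1 = v -> far_end v e = e.2.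
Proof.
move=> /andP[_ lt] e1; rewrite /far_end; case: eqP => // e2.
by move: lt; rewrite e1 e2 ltxx.
Qed.

Lemma far_end_of_top v e : e.2 = v -> far_end v e = e.1.
Proof. by rewrite /far_end => ->; rewrite eqxx. Qed.

(** Turning around [v] from the direction [(-1, 0)], one meets the incoming edges
    from left to right, and then the outgoing ones from right to left: this is
    why [u] is reversed. *)
Lemma vertex_sign_changes v (d u : seq (V * V)) :
  (forall e, (e \in d) = upward_edge e && (e.2 == v)) ->
  (forall e, (e \in u) = upward_edge e && (e.1 == v)) ->
  pairwise (fun e f => half_tan v (far_end v e) < half_tan v (far_end v f))
     (d ++ rev u) ->
  d ++ u = [::] \/ 3 <= adjsum (sign_change positive_stress) (d ++ rev u).
Proof.
move=> dE uE ord.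
have [nil|nil] := eqVneq (d ++ u) [::]; [by left | right].
have mem e : e \in d ++ rev u -> w v (far_end v e) = w e.1 e.2 /\ w e.1 e.2 != 0.
  rewrite mem_cat mem_rev dE uE => /orP[] /andP[ee /eqP ev].
    by rewrite far_end_of_top // -ev w_sym; have /andP[] := ee.
  by rewrite (far_end_of_bottom ee) // -ev; have /andP[] := ee.
have sgn e : e \in d ++ rev u -> (0 < moment_weight v (far_end v e)) = positive_stress e.
  move=> /mem[we nz]; rewrite /moment_weight /positive_stress we pmulr_lgt0 //.
  by apply: half_tan_denom; rewrite we.
have <- : adjsum (sign_change (fun e => 0 < moment_weight v (far_end v e))) (d ++ rev u)
        = adjsum (sign_change positive_stress) (d ++ rev u).
  have congr_adj s : {in s, forall e, (0 < moment_weight v (far_end v e)) = positive_stress e} ->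
      adjsum (sign_change (fun e => 0 < moment_weight v (far_end v e))) s
      = adjsum (sign_change positive_stress) s.
    case: s => // x s /=; elim: s x => //= y s IH x sE; congr (_ + _).
      by rewrite /sign_change !sE // !inE eqxx ?orbT.
    by apply: IH => z zs; apply: sE; rewrite inE zs orbT.
  exact: congr_adj.
apply: (@three_sign_changes _ _ (fun e => half_tan v (far_end v e))) => //.
- move: nil; rewrite -!size_eq0 !size_cat size_rev //.
- move=> e /mem[we nz]; rewrite mulf_neq0 ?we // gt_eqF // half_tan_denom //.
  by rewrite we.
move=> k k3; rewrite -[RHS](vertex_moments v k3).
rewrite -(big_map (far_end v) predT (fun j => moment_weight v j * half_tan v j ^+ k)).
rewrite [RHS](bigID (fun j => w v j != 0)) /= [X in _ = _ + X]big1 ?addr0; last first.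
  by move=> j; rewrite negbK => /eqP wj; rewrite /moment_weight wj !mul0r.
rewrite -[RHS]big_filter; apply: perm_big; apply: uniq_perm.
- have: uniq (map (half_tan v) (map (far_end v) (d ++ rev u))).
    apply: (@sorted_uniq _ <%R); [exact: lt_trans | exact: ltxx |].
    rewrite -map_comp sorted_pairwise; last exact: lt_trans.
    by rewrite pairwise_map.
  exact: map_uniq.
- by rewrite filter_uniq // index_enum_uniq.
move=> j; rewrite mem_filter mem_index_enum andbT; apply/mapP/idP.
  by move=> [e /mem[we nz] ->]; rewrite we.
move=> nz; have [nvj _] := contact nz.
have := inj_eq py_inj v j; rewrite (negPf nvj).
case: (ltgtP (py v) (py j)) => // lt _.
  exists (v, j); last by rewrite far_end_of_bottom // /upward_edge nz.
  by rewrite mem_cat mem_rev uE /upward_edge nz lt eqxx orbT.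
exists (j, v); last by rewrite far_end_of_top.
by rewrite mem_cat dE /upward_edge w_sym nz lt eqxx.
Qed.

Definition active (B : {pred V}) e :=
  [&& upward_edge e, e.1 \in B & e.2 \notin B].

(** [B] is the set of vertices below the line and [s] lists the edges that the line
    meets, from left to right. *)
Definition sweep_status (B : {pred V}) (s : seq (V * V)) :=
  [/\ forall e, (e \in s) = active B e, pairwise left_of s,
      adjsum (gap_weight positive_stress same_bottom) s <= 0
    & (exists2 e, upward_edge e & e.1 \in B) ->
      adjsum (gap_weight positive_stress same_bottom) s < 0].

Lemma incoming_edges_sorted v d :
  (forall e, (e \in d) = upward_edge e && (e.2 == v)) ->
  pairwise left_of d ->
  pairwise (fun e f => half_tan v (far_end v e) < half_tan v (far_end v f)) d.
Proof.
move=> dE; apply: sub_in_pairwise (allss d) => e f /=.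
rewrite !dE => /andP[ee /eqP ev] /andP[ef /eqP fv] lef.
rewrite !far_end_of_top //.
have wv g : upward_edge g -> g.2 = v -> w v g.1 != 0 /\ py g.1 < py v.
  by move=> /andP[nz lt] gv; rewrite -gv w_sym.
have [we ye] := wv e ee ev; have [wf yf] := wv f ef fv.
rewrite half_tan_mono //; last first.
  by rewrite nmulr_rgt0 half_tan_lt0.
have ov : overlap e f by rewrite /overlap fv ye ev.
have [/andP[_ m2] _] := mid_height_in ee ef ov.
move: lef; rewrite /left_of !abscissa_topE // ev fv ltrD2l /inv_slope ev fv.
rewrite ltr_nM2l ?subr_lt0 -?ev //.
by rewrite -[X in _ / X]opprB -[X in X / _]opprB -[X in _ < _ / X]opprB
   -[X in _ < X / _]opprB !invrN !mulrNN.
Qed.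

(** Above [v], a smaller angle is further to the right. *)
Definition outgoing_edges v :=
  sort (fun e f => half_tan v (far_end v f) <= half_tan v (far_end v e))
    [seq e <- enum {: V * V} | upward_edge e & e.1 == v].

Lemma mem_outgoing v e : (e \in outgoing_edges v) = upward_edge e && (e.1 == v).
Proof. by rewrite mem_sort mem_filter mem_enum andbT. Qed.

Lemma outgoing_edges_sorted v :
  pairwise (fun e f => half_tan v (far_end v f) < half_tan v (far_end v e))
    (outgoing_edges v).
Proof.
set le := fun e f => half_tan v (far_end v f) <= half_tan v (far_end v e).
have : pairwise le (outgoing_edges v).
  rewrite -sorted_pairwise; last by move=> y x z; rewrite /le => /[swap]; apply: le_trans.
  by apply: sort_sorted => x y; rewrite /le le_total.
have : uniq (outgoing_edges v) by rewrite sort_uniq filter_uniq // enum_uniq.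
rewrite uniq_pairwise => un le'; have := conj un le'; move/andP.
rewrite -pairwise_relI; apply: sub_in_pairwise (allss _) => e f /=.
rewrite !mem_outgoing => /andP[ee /eqP ev] /andP[ef /eqP fv] /andP[ne].
rewrite /le le_eqVlt => /predU1P[eq|//].
have wv g : upward_edge g -> g.1 = v -> w v g.2 != 0.
  by move=> /andP[nz lt] gv; rewrite -gv.
have sl : inv_slope e = inv_slope f.
  rewrite /inv_slope ev fv !half_tan_slope ?wv //.
  by move: eq; rewrite !far_end_of_bottom // => ->.
have ov : overlap e f.
  by rewrite /overlap ev -{1}fv fv -ev; have /andP[_ ->] := ee; rewrite ev -fv; have /andP[_ ->] := ef.
have [m1 m2] := mid_height_in ee ef ov.
case/eqP: ne; apply: noncrossing m1 m2 _ => //.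
by rewrite /abscissa sl ev fv.
Qed.

Lemma outgoing_left_of v : pairwise left_of (outgoing_edges v).
Proof.
apply: sub_in_pairwise (allss _) (outgoing_edges_sorted v) => e f /=.
rewrite !mem_outgoing => /andP[ee /eqP ev] /andP[ef /eqP fv].
rewrite !far_end_of_bottom //.
have wv g : upward_edge g -> g.1 = v -> w v g.2 != 0 /\ py v < py g.2.
  by move=> /andP[nz lt] gv; rewrite -gv.
have [we ye] := wv e ee ev; have [wf yf] := wv f ef fv.
rewrite half_tan_mono //; last by rewrite pmulr_rgt0 half_tan_gt0.
have ov : overlap e f by rewrite /overlap ev fv yf ye.
move=> sl; have [/andP[m1 _] _] := mid_height_in ee ef ov.
by rewrite /left_of /abscissa /inv_slope ev fv ltrD2l ltr_pM2l // subr_gt0 -{1}ev.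
Qed.

(** The edges met just below [v] are sorted by their abscissa at the height of [v],
    and those that pass through [v] end there, since a segment between the
    centres of touching disks meets no other centre. This splits the list as
    required by [sweep_step]. *)
Lemma sweep_vertex v s : sweep_status [pred u | py u < py v] s ->
  exists s', sweep_status [pred u | py u <= py v] s'.
Proof.
move=> [sE ord psi psi'].
have activeP e : e \in s -> [/\ upward_edge e, py e.1 < py v & py v <= py e.2].
  by rewrite sE /active !inE -leNgt => /and3P[].
have ovs e f : e \in s -> f \in s -> overlap e f.
  move=> /activeP[_ e1 e2] /activeP[_ f1 f2].
  by rewrite /overlap (lt_le_trans e1) ?(lt_le_trans f1).
have in_v e : e \in s -> py e.1 <= py v <= py e.2.
  by move=> /activeP[_ /ltW-> ->].
have key_top e : e \in s -> (abscissa e (py v) == px v) = (e.2 == v).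
  move=> es; have [ee e1 e2] := activeP _ es.
  apply/eqP/eqP => [eX|<-]; last exact: abscissa_top.
  apply/eqP; apply: contraTT isT => ne2.
  have ne1 : e.1 != v by apply: contraTneq e1 => ->; rewrite ltxx.
  have [t t01 [tx ty]] := abscissa_param ee (in_v _ es).
  have [/contact[_ c] _] := andP ee.
  exfalso; apply: (vertex_off_segment (r_gt0 e.1) (r_gt0 e.2) (r_gt0 v) t01 _ ty c).
  - by rewrite -tx eX.
  - exact: disjoint_disks.
  - exact: disjoint_disks.
pose L := [seq e <- s | abscissa e (py v) < px v].
pose d := [seq e <- s | e.2 == v].
pose R' := [seq e <- s | px v < abscissa e (py v)].
pose u := outgoing_edges v.
have split_s : s = L ++ d ++ R'.
  rewrite [LHS](@pairwise_le_split _ _ (fun e => abscissa e (py v)) (px v)).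
    by congr (_ ++ (_ ++ _)); apply: eq_in_filter => e /key_top.
  apply: sub_in_pairwise (allss s) ord => e f es fs lef.
  by apply: left_of_le (in_v _ es) (in_v _ fs) lef; rewrite ?ovs //;
     [case: (activeP _ es)|case: (activeP _ fs)].
have dE e : (e \in d) = upward_edge e && (e.2 == v).
  rewrite mem_filter andbC; apply/andP/andP => -[].
    by move=> /activeP[-> _ _] ->.
  move=> ee /eqP ev; rewrite sE /active ee !inE ev ltxx eqxx andbT.
  by rewrite -ev; have /andP[] := ee.
have uE := mem_outgoing v.
have memL e : e \in L -> [/\ e \in s, abscissa e (py v) < px v & e.2 != v].
  by rewrite mem_filter => /andP[lt es]; split=> //; rewrite -key_top // lt_eqF.
have memR e : e \in R' -> [/\ e \in s, px v < abscissa e (py v) & e.2 != v].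
  by rewrite mem_filter => /andP[lt es]; split=> //; rewrite -key_top // gt_eqF.
have [ordL ordR ordLR ordd] : [/\ pairwise left_of L, pairwise left_of R',
    allrel left_of L R' & pairwise left_of d].
  move: ord; rewrite split_s !pairwise_cat allrel_catr.
  by move=> /and3P[/andP[_ ->] -> /and3P[_ -> ->]].
have outE f : f \in u -> [/\ upward_edge f, f.1 = v & py v < py f.2].
  by rewrite uE => /andP[ef /eqP fv]; split=> //; rewrite -fv; have /andP[] := ef.
have ordLu : allrel left_of L u.
  apply/allrelP => e f /memL[es lt ne] /outE[ef fv f2].
  have [ee e1 e2] := activeP _ es.
  have lt2 : py v < py e.2 by rewrite lt_neqAle e2 (inj_eq py_inj) eq_sym ne.
  apply: (@left_ofI _ _ (py v)); rewrite ?(in_v _ es) //.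
  - by rewrite /overlap fv lt2 (lt_trans e1).
  - by rewrite fv lexx ltW.
  - by rewrite -{2}fv abscissa_bottom fv.
have orduR : allrel left_of u R'.
  apply/allrelP => f e /outE[ef fv f2] /memR[es lt ne].
  have [ee e1 e2] := activeP _ es.
  have lt2 : py v < py e.2 by rewrite lt_neqAle e2 (inj_eq py_inj) eq_sym ne.
  apply: (@left_ofI _ _ (py v)); rewrite ?(in_v _ es) //.
  - by rewrite /overlap fv lt2 (lt_trans e1).
  - by rewrite fv lexx ltW.
  - by rewrite -{1}fv abscissa_bottom fv.
have ht0 e : e \in d -> half_tan v (far_end v e) < 0.
  rewrite dE => /andP[/andP[nz lt] /eqP ev].
  by rewrite far_end_of_top // half_tan_lt0 -?ev // w_sym.
have ht1 e : e \in u -> 0 < half_tan v (far_end v e).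
  move=> /outE[ee ev lt]; have [nz _] := andP ee.
  by rewrite far_end_of_bottom // half_tan_gt0 -?ev // ev.
have changes := @vertex_sign_changes v d u dE uE.
have {}changes : d ++ u = [::] \/ 3 <= adjsum (sign_change positive_stress) (d ++ rev u).
  apply: changes; rewrite pairwise_cat incoming_edges_sorted //=.
  apply/andP; split.
    by apply/allrelP => e f /ht0 e0; rewrite mem_rev => /ht1; apply: lt_trans.
  have tr : transitive (fun e f => half_tan v (far_end v e) < half_tan v (far_end v f)).
    by move=> y x z; apply: lt_trans.
  rewrite -sorted_pairwise // rev_sorted sorted_pairwise; last first.
    by move=> y x z /[swap]; apply: lt_trans.
  exact: outgoing_edges_sorted.
(* The new gaps at the sides of [v] are not fresh: the edges that were already
   met start strictly below [v]. *)
have step : adjsum (gap_weight positive_stress same_bottom) (L ++ u ++ R') <=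
            adjsum (gap_weight positive_stress same_bottom) s.
  rewrite split_s; apply: sweep_step changes.
  - move=> e f; rewrite !dE => /andP[_ /eqP ev] /andP[_ /eqP fv] /eqP ef.
    by congr positive_stress; rewrite [e]surjective_pairing [f]surjective_pairing ef ev fv.
  - by move=> e f /outE[_ ev _] /outE[_ fv _]; rewrite /same_bottom ev fv.
  - move=> e f /memL[es _ _] /outE[_ fv _]; have [_ e1 _] := activeP _ es.
    by rewrite /same_bottom fv; apply: contraTneq e1 => ->; rewrite ltxx.
  - move=> f e /outE[_ fv _] /memR[es _ _]; have [_ e1 _] := activeP _ es.
    by rewrite /same_bottom fv; apply: contraTneq e1 => <-; rewrite ltxx.
exists (L ++ u ++ R'); split.
- move=> e; rewrite !mem_cat /active !inE -ltNge.
  apply/or3P/and3P => [[/memL[es _ ne]|/outE[ee -> lt]|/memR[es _ ne]]|[ee]].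
  + have [ee e1 e2] := activeP _ es; split=> //; first exact: ltW.
    by rewrite lt_neqAle e2 (inj_eq py_inj) eq_sym ne.
  + by rewrite lexx lt.
  + have [ee e1 e2] := activeP _ es; split=> //; first exact: ltW.
    by rewrite lt_neqAle e2 (inj_eq py_inj) eq_sym ne.
  rewrite le_eqVlt (inj_eq py_inj) => /predU1P[e1 e2|e1 e2].
    by constructor 2; rewrite uE ee e1 eqxx.
  have es : e \in s by rewrite sE /active ee !inE e1 -leNgt ltW.
  move: (es); rewrite {1}split_s !mem_cat => /or3P[eL|/[!dE]/andP[_ /eqP ev]|eR].
  + by constructor 1.
  + by move: e2; rewrite ev ltxx.
  + by constructor 3.
- by rewrite !pairwise_cat allrel_catr ordLu ordLR ordL orduR ordR outgoing_left_of.
- exact: le_trans psi.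
move=> [e ee]; rewrite inE => ev.
(* If no edge was met before, the list becomes [u], with at least three changes,
   all in fresh gaps. *)
have [/existsP[f /andP[ef fv]]|none] :=
  boolP [exists f, upward_edge f && (py f.1 < py v)].
  by apply: le_lt_trans step (psi' _); exists f.
have s0 : s = [::].
  case: (s) activeP => // f s' /(_ f); rewrite inE eqxx => /(_ isT)[ef lt _].
  by case/existsP: none; exists f; rewrite ef.
have [L0 d0 R0] : [/\ L = [::], d = [::] & R' = [::]] by rewrite /L /d /R' s0.
have eu : e \in u.
  rewrite uE ee; apply: contraNT none => ne; apply/existsP; exists e.
  by rewrite ee lt_neqAle ev (inj_eq py_inj) ne.
rewrite L0 R0 cats0 /= adjsum_gap_fresh; last first.
  by move=> e1 e2 /outE[_ ev1 _] /outE[_ ev2 _]; rewrite /same_bottom ev1 ev2.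
move: changes; rewrite d0 /= adjsum_rev oppr_lt0 => -[u0|]; last exact: lt_le_trans.
by rewrite u0 in eu.
Qed.

Lemma stress_eq0_generic i j : w i j = 0.
Proof.
have status (B : {set V}) :
    (forall x y, y \in B -> py x <= py y -> x \in B) ->
    exists s, sweep_status [pred x | x \in B] s.
  move: {2}#|B|.+1 (ltnSn #|B|) => k; elim: k B => // k IH B Bk down.
  have [->|/set0Pn[v0 v0B]] := eqVneq B finset.set0.
    exists [::]; split=> //; first by move=> e; rewrite /active !inE andbF.
    by move=> [e _]; rewrite !inE.
  pose v := [arg max_(x > v0 in B) py x]%O.
  have [vB vmax] : v \in B /\ forall x, x \in B -> py x <= py v.
    by rewrite /v; case: Order.TotalTheory.arg_maxP => // x xB xm; split=> // y /xm.
  have BE x : (x \in B) = (py x <= py v).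
    by apply/idP/idP => [/vmax//|]; exact: down.
  have B'E x : (x \in B :\ v) = (py x < py v).
    by rewrite !inE BE lt_neqAle (inj_eq py_inj).
  have [||s [sE ord psi psi']] := IH (B :\ v).
  - by rewrite -ltnS (leq_trans _ Bk) // ltnS [in X in (_ < X)%N](cardsD1 v B) vB.
  - by move=> x y; rewrite !B'E => yv xy; apply: le_lt_trans yv.
  have [|s' [sE' ord' q q']] := @sweep_vertex v s.
    split=> //.
      by move=> e; rewrite sE /active [e.1 \in _]B'E [e.2 \in _]B'E.
    by move=> [e ee e1]; apply: psi'; exists e => //; rewrite [_ \in _]B'E.
  exists s'; split=> //.
    by move=> e; rewrite sE' /active !inE -!BE.
  by move=> [e ee e1]; apply: q'; exists e => //; rewrite inE -BE.
have [|s [sE _ _ psi]] := status finset.setT; first by move=> x y; rewrite !inE.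
have s0 : s = [::].
  case: s sE {psi} => // e s /(_ e).
  by rewrite /active !inE eqxx !andbF.
have no_edge e : ~~ upward_edge e.
  apply/negP => ee; have : adjsum (gap_weight positive_stress same_bottom) s < 0.
    by apply: psi; exists e => //; rewrite !inE.
  by rewrite s0.
apply/eqP; apply: contraT => nz; have [nij _] := contact nz.
have := inj_eq py_inj i j; rewrite (negPf nij).
case: (ltgtP (py i) (py j)) => // lt _.
  by have := no_edge (i, j); rewrite /upward_edge nz lt.
by have := no_edge (j, i); rewrite /upward_edge w_sym nz lt.
Qed.

End Sweep.

(** * Vanishing of the stresses of a packing *)

Lemma exists_nonroot (R : realFieldType) (P : {poly R}) : P != 0 ->
  exists t, ~~ root P t.
Proof.
move=> nz; pose rs : seq R := [seq i%:R | i <- iota 0 (size P)].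
have [/allPn[t _ nt]|roots] := boolP (~~ all (root P) rs); first by exists t.
have := max_poly_roots nz (negbNE roots).
by rewrite size_map size_iota ltnn map_inj_uniq ?iota_uniq => [/(_ isT)|m n /eqP/[!eqr_nat]/eqP].
Qed.

(** The rotations are parametrized rationally; each pair of points forbids the
    roots of one nonzero polynomial. *)
Lemma injective_rotated_ordinate (R : realFieldType) (V : finType) (px py : V -> R) :
  injective (fun i => (px i, py i)) ->
  exists c s : R, c ^+ 2 + s ^+ 2 = 1 /\ injective (fun i => c * py i + s * px i).
Proof.
move=> inj.
pose q (ij : V * V) : {poly R} :=
  (1 - 'X^2) * (py ij.1 - py ij.2)%:P + 2%:P * 'X * (px ij.1 - px ij.2)%:P.
have qE ij t : (q ij).[t] =
    (1 - t ^+ 2) * (py ij.1 - py ij.2) + 2 * t * (px ij.1 - px ij.2).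
  by rewrite /q !hornerE.
have [|t] := @exists_nonroot _ (\prod_(ij | ij.1 != ij.2) q ij).
  apply/prodf_neq0 => ij ne; apply: contra ne => /eqP q0; apply/eqP/inj.
  have := qE ij 0; have := qE ij 1; rewrite q0 !horner0 => e1 e0.
  by congr pair; lra.
rewrite rootE horner_prod => /prodf_neq0 nz.
have D0 : 0 < 1 + t ^+ 2 by rewrite ltr_pwDl ?sqr_ge0.
exists ((1 - t ^+ 2) / (1 + t ^+ 2)), (2 * t / (1 + t ^+ 2)); split.
  by field; rewrite gt_eqF.
move=> i j eij; apply/eqP; apply: contraT => /(nz (i, j)) /=.
rewrite qE /= => /negP[]; apply/eqP.
move/eqP: eij; rewrite -subr_eq0 => /eqP eij.
apply: (mulIf (invr_neq0 (lt0r_neq0 D0))); rewrite mul0r -eij; ring.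
Qed.

(** A rotation preserves the hypotheses and separates the heights of the
    centres. *)
Theorem contact_stress_trivial (R : realFieldType) (V : finType)
    (px py r : V -> R) (w : V -> V -> R) :
  (forall i, 0 < r i) ->
  (forall i j, i != j ->
    (r i + r j) ^+ 2 <= (px i - px j) ^+ 2 + (py i - py j) ^+ 2) ->
  (forall i j, w i j = w j i) ->
  (forall i j, w i j != 0 -> i != j /\
    (px i - px j) ^+ 2 + (py i - py j) ^+ 2 = (r i + r j) ^+ 2) ->
  (forall i, \sum_j w i j * (px i - px j) = 0) ->
  (forall i, \sum_j w i j * (py i - py j) = 0) ->
  (forall i, \sum_j w i j * (r i + r j) = 0) ->
  forall i j, w i j = 0.
Proof.
move=> r0 disj wC contact ex ey er.
have [|c [s [cs inj]]] := @injective_rotated_ordinate _ _ px py.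
  move=> i j [exy eyy]; apply/eqP; apply: contraT => /disj.
  rewrite exy eyy !subrr expr0n addr0 leNgt exprn_gt0 // addr_gt0 //.
have dist i j : (c * px i - s * py i - (c * px j - s * py j)) ^+ 2 +
    (c * py i + s * px i - (c * py j + s * px j)) ^+ 2 =
    (px i - px j) ^+ 2 + (py i - py j) ^+ 2.
  by rewrite -[RHS]mul1r -cs; ring.
apply: (@stress_eq0_generic _ _ (fun i => c * px i - s * py i)
  (fun i => c * py i + s * px i) r w) => //.
- by move=> i j /disj; rewrite dist.
- by move=> i j; rewrite dist; apply: contact.
- move=> i; transitivity (c * (\sum_j w i j * (px i - px j))
                         - s * (\sum_j w i j * (py i - py j))).
    by rewrite !mulr_sumr -sumrB; apply: eq_bigr => j _; ring.
  by rewrite ex ey !mulr0 subrr.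
- move=> i; transitivity (c * (\sum_j w i j * (py i - py j))
                         + s * (\sum_j w i j * (px i - px j))).
    by rewrite !mulr_sumr -big_split; apply: eq_bigr => j _ /=; ring.
  by rewrite ex ey !mulr0 addr0.
Qed.

(** * Real functions of class C^k *)

Section RealClassC.
Variables (R : realType) (N : nat).
Implicit Types (U : set 'rV[R]_N) (f g : 'rV[R]_N -> R).

Local Notation basis i := (delta_mx 0 i : 'rV[R]_N).

(** The scalar counterpart of [class_C], for which products and inverses make
    sense. *)
Fixpoint real_class_C k U f : Prop :=
  {in U, continuous f} /\
  if k is k'.+1 then
    forall i : 'I_N, {in U, forall x, derivable f x (basis i)} /\
      real_class_C k' U (fun x => 'D_(basis i) f x)
  else True.

Lemma real_class_C_continuous k U f : real_class_C k U f -> {in U, continuous f}.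
Proof. by case: k => [|k] []. Qed.

Lemma eq_on_open_near U f g x : open U -> U x -> {in U, f =1 g} ->
  \forall y \near x, f y = g y.
Proof.
move=> Uo Ux fg; have : nbhs x U by exact: open_nbhs_nbhs.
by apply: filterS => y Uy; apply: fg; rewrite inE.
Qed.

Lemma is_derive_eq_on U f g x v df : open U -> U x -> {in U, f =1 g} ->
  is_derive x v f df -> is_derive x v g df.
Proof.
by move=> Uo Ux fg; apply: near_eq_is_derive; apply: eq_on_open_near fg.
Qed.

Lemma is_derive_cvg f x v df :
  h^-1 *: (f (h *: v + x) - f x) @[h --> 0^'] --> df -> is_derive x v f df.
Proof.
move=> lim; apply: DeriveDef; last exact: cvg_lim.
by apply/cvg_ex; exists df.
Qed.

(** The condition only depends on the values on the open set [U]: partial derivatives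
    in closed form on [U] may replace the derivative operator in proofs by induction
    on [k]. *)
Lemma eq_real_class_C k U f g : open U -> {in U, f =1 g} ->
  real_class_C k U f -> real_class_C k U g.
Proof.
move=> Uo; elim: k f g => [|k IH] f g fg [cf Cf].
  split=> // x Ux; rewrite /continuous_at -fg //.
  apply: cvg_trans (cf x Ux); apply: (@near_eq_cvg _ _ (nbhs x)).
  by apply: eq_on_open_near fg => //; exact: set_mem.
have deq i x : x \in U -> 'D_(basis i) f x = 'D_(basis i) g x.
  move=> Ux; have [/(_ x Ux)/derivableP df _] := Cf i.
  by have [_ ->] := is_derive_eq_on Uo (set_mem Ux) fg df.
split=> [x Ux|i].
  rewrite /continuous_at -fg //.
  apply: cvg_trans (cf x Ux); apply: (@near_eq_cvg _ _ (nbhs x)).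
  by apply: eq_on_open_near fg => //; exact: set_mem.
have [df Cdf] := Cf i; split=> [x Ux|].
  by have [] := is_derive_eq_on Uo (set_mem Ux) fg (derivableP (df x Ux)).
by apply: IH Cdf => x Ux; exact: deq.
Qed.

(** The form in which the closure properties are proved: the partial derivatives
    are given by formulas, and are of class [C^k] by induction. *)
Lemma real_class_CS k U f : open U -> {in U, continuous f} ->
  (forall i, exists2 g, {in U, forall x, is_derive x (basis i) f (g x)} &
                        real_class_C k U g) -> real_class_C k.+1 U f.
Proof.
move=> Uo cf df; split=> // i; have [g dg Cg] := df i.
split=> [x Ux|]; first by have [] := dg x Ux.
by apply: eq_real_class_C Cg => // x Ux; have [_ ->] := dg x Ux.
Qed.

Lemma real_class_C_is_derive k U f i : real_class_C k.+1 U f ->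
  {in U, forall x, is_derive x (basis i) f ('D_(basis i) f x)} /\
  real_class_C k U (fun x => 'D_(basis i) f x).
Proof.
by move=> [_ /(_ i)[df Cf]]; split=> // x Ux; apply/derivableP/df.
Qed.

Lemma real_class_C_pred k U f : real_class_C k.+1 U f -> real_class_C k U f.
Proof.
elim: k f => [|k IH] f [cf df]; first by split.
by split=> // i; have [? ?] := df i; split=> //; exact: IH.
Qed.

Lemma real_class_C_cst k U c : open U -> real_class_C k U (fun=> c).
Proof.
move=> Uo; elim: k c => [|k IH] c.
  by split=> // x _; apply: cst_continuous.
apply: real_class_CS => // [x _|i]; first exact: cst_continuous.
by exists (fun=> 0); [move=> x _; exact: is_derive_cst|exact: IH].
Qed.

Lemma real_class_C_coord k U j : open U -> real_class_C k U (fun x => x 0 j).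
Proof.
move=> Uo; case: k => [|k].
  by split=> // x _; exact: coord_continuous.
apply: real_class_CS => // [x _|i]; first exact: coord_continuous.
exists (fun=> basis i 0 j); last exact: real_class_C_cst.
move=> x _; apply: is_derive_cvg; apply: cvg_near_cst.
near=> h; have h0 : h != 0 by near: h; exact: nbhs_dnbhs_neq.
by rewrite !mxE addrK /GRing.scale /= mulKf.
Unshelve. all: by end_near. Qed.

Lemma real_class_CD k U f g : open U -> real_class_C k U f ->
  real_class_C k U g -> real_class_C k U (fun x => f x + g x).
Proof.
move=> Uo; elim: k f g => [|k IH] f g Cf Cg.
  split=> // x Ux.
  exact: (continuousD (real_class_C_continuous Cf Ux) (real_class_C_continuous Cg Ux)).
apply: real_class_CS => // [x Ux|i].
  exact: (continuousD (real_class_C_continuous Cf Ux) (real_class_C_continuous Cg Ux)).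
have [df Cdf] := real_class_C_is_derive i Cf.
have [dg Cdg] := real_class_C_is_derive i Cg.
exists (fun x => 'D_(basis i) f x + 'D_(basis i) g x); last exact: IH.
by move=> x Ux; apply: is_deriveD; [exact: df|exact: dg].
Qed.

Lemma real_class_CM k U f g : open U -> real_class_C k U f ->
  real_class_C k U g -> real_class_C k U (fun x => f x * g x).
Proof.
move=> Uo; elim: k f g => [|k IH] f g Cf Cg.
  split=> // x Ux.
  exact: (continuousM (real_class_C_continuous Cf Ux) (real_class_C_continuous Cg Ux)).
apply: real_class_CS => // [x Ux|i].
  exact: (continuousM (real_class_C_continuous Cf Ux) (real_class_C_continuous Cg Ux)).
have [df Cdf] := real_class_C_is_derive i Cf.
have [dg Cdg] := real_class_C_is_derive i Cg.
exists (fun x => f x * 'D_(basis i) g x + g x * 'D_(basis i) f x).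
  by move=> x Ux; apply: is_deriveM; [exact: df|exact: dg].
by apply: real_class_CD => //; apply: IH => //; exact: real_class_C_pred.
Qed.

Lemma real_class_CV k U f : open U -> {in U, forall x, f x != 0} ->
  real_class_C k U f -> real_class_C k U (fun x => (f x)^-1).
Proof.
move=> Uo nz; elim: k => [|k IH] Cf.
  split=> // x Ux.
  exact: (continuousV (nz x Ux) (real_class_C_continuous Cf Ux)).
apply: real_class_CS => // [x Ux|i].
  exact: (continuousV (nz x Ux) (real_class_C_continuous Cf Ux)).
have [df Cdf] := real_class_C_is_derive i Cf.
exists (fun x => -1 * ((f x)^-1 * (f x)^-1) * 'D_(basis i) f x).
  move=> x Ux; have dfx := df x Ux; apply: DeriveDef.
    by apply: derivableV; [exact: nz|exact: ex_derive].
  rewrite deriveV; [|exact: nz|exact: ex_derive].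
  by rewrite mulN1r -invfM -expr2.
have CV := IH (real_class_C_pred Cf).
apply: real_class_CM => //; apply: real_class_CM => //.
  exact: real_class_C_cst.
exact: real_class_CM.
Qed.

Lemma real_class_C_sum k U (I : Type) (s : seq I) (P : pred I) (F : I -> 'rV[R]_N -> R) :
  open U -> (forall i, real_class_C k U (F i)) ->
  real_class_C k U (fun x => \sum_(i <- s | P i) F i x).
Proof.
move=> Uo CF; elim: s => [|i s IH].
  apply: eq_real_class_C (real_class_C_cst k 0 Uo) => // x _.
  by rewrite big_nil.
have [Pi|nPi] := boolP (P i).
  apply: eq_real_class_C (real_class_CD Uo (CF i) IH) => // x _.
  by rewrite big_cons Pi.
by apply: eq_real_class_C IH => // x _; rewrite big_cons (negPf nPi).
Qed.

Lemma real_class_C_prod k U (I : Type) (s : seq I) (P : pred I) (F : I -> 'rV[R]_N -> R) :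
  open U -> (forall i, real_class_C k U (F i)) ->
  real_class_C k U (fun x => \prod_(i <- s | P i) F i x).
Proof.
move=> Uo CF; elim: s => [|i s IH].
  apply: eq_real_class_C (real_class_C_cst k 1 Uo) => // x _.
  by rewrite big_nil.
have [Pi|nPi] := boolP (P i).
  apply: eq_real_class_C (real_class_CM Uo (CF i) IH) => // x _.
  by rewrite big_cons Pi.
by apply: eq_real_class_C IH => // x _; rewrite big_cons (negPf nPi).
Qed.

Lemma real_class_C_det k U n (M : 'rV[R]_N -> 'M[R]_n) : open U ->
  (forall i j, real_class_C k U (fun x => M x i j)) ->
  real_class_C k U (fun x => \det (M x)).
Proof.
move=> Uo CM; apply: real_class_C_sum => // s.
by apply: real_class_CM => //; [exact: real_class_C_cst|exact: real_class_C_prod].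
Qed.

(** By Cramer's formula. *)
Lemma real_class_C_invmx k U n (M : 'rV[R]_N -> 'M[R]_n) i j : open U ->
  {in U, forall x, M x \in unitmx} ->
  (forall i j, real_class_C k U (fun x => M x i j)) ->
  real_class_C k U (fun x => invmx (M x) i j).
Proof.
move=> Uo unit CM.
have CV : real_class_C k U (fun x => (\det (M x))^-1).
  apply: real_class_CV => //; last exact: real_class_C_det.
  by move=> x /unit; rewrite unitmxE unitfE.
apply: (@eq_real_class_C _ _ (fun x => (\det (M x))^-1 *
    ((-1) ^+ (j + i) * \det (row' j (col' i (M x)))))) => //.
  by move=> x Ux; rewrite /invmx unit // !mxE.
apply: real_class_CM => //; apply: real_class_CM => //; first exact: real_class_C_cst.
apply: real_class_C_det => // a b.
by apply: eq_real_class_C (CM (lift j a) (lift i b)) => // x _; rewrite !mxE.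
Qed.

Lemma continuous_coords m n (T : topologicalType) (M : T -> 'M[R]_(m, n)) x :
  (forall i j, {for x, continuous (fun y => M y i j)}) -> {for x, continuous M}.
Proof.
move=> cM; apply/cvgrPdist_lt => /= e e0.
have : \forall y \near x, forall ij : 'I_m * 'I_n,
    `|M x ij.1 ij.2 - M y ij.1 ij.2| < e.
  apply: filter_forall => ij.
  by have /cvgrPdist_lt/(_ e e0) := cM ij.1 ij.2.
apply: filterS => y My; rewrite /Num.norm /= mx_normrE.
by apply/bigmax_ltP; split=> // ij _; rewrite !mxE.
Qed.

Lemma class_C_coords M k U (f : 'rV[R]_N -> 'rV[R]_M) : open U ->
  (forall j, real_class_C k U (fun x => f x 0 j)) -> class_C k U f.
Proof.
move=> Uo; elim: k f => [|k IH] f Cf.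
  split=> // x Ux; apply: continuous_coords => i j; rewrite ord1.
  exact: (real_class_C_continuous (Cf j)).
have df i x : x \in U -> derivable f x (basis i).
  move=> Ux; apply/derivable_mxP => a j; rewrite ord1.
  by have [/(_ x Ux) [? _] _] := real_class_C_is_derive i (Cf j).
split=> [x Ux|i].
  apply: continuous_coords => a j; rewrite ord1.
  exact: (real_class_C_continuous (Cf j)).
split=> [x|]; first exact: df.
apply: IH => j; have [_ Cdf] := real_class_C_is_derive i (Cf j).
by apply: eq_real_class_C Cdf => // x Ux; rewrite derive_mx ?mxE //; exact: df.
Qed.

End RealClassC.

(** * Quadratic maps are locally onto *)

(** Matrix spaces are complete and normed; this registers the join of the two
    structures, which the fixed point theorem requires. *)
HB.instance Definition _ (R : realType) (m n : nat) :=
  Uniform_isComplete.Build 'M[R]_(m, n) cauchy_cvg.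

Section MatrixNorm.
Variable R : realType.

Lemma mx_norm_coord_le m n (A : 'M[R]_(m, n)) c : 0 <= c ->
  (forall i j, `|A i j| <= c) -> `|A| <= c.
Proof.
move=> c0 Ac; rewrite /Num.norm /= mx_normrE.
by apply/bigmax_leP; split=> // ij _; exact: Ac.
Qed.

Lemma coord_le_mx_norm m n (A : 'M[R]_(m, n)) i j : `|A i j| <= `|A|.
Proof.
by rewrite [leRHS]/Num.norm /= mx_normrE (le_bigmax _ _ (i, j)).
Qed.

Lemma mulmx_norm_le m n p (A : 'M[R]_(m, n)) (B : 'M[R]_(n, p)) :
  `|A *m B| <= n%:R * `|A| * `|B|.
Proof.
apply: mx_norm_coord_le => [|i j]; first by rewrite !mulr_ge0.
rewrite mxE (le_trans (ler_norm_sum _ _ _)) //.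
have -> : n%:R * `|A| * `|B| = \sum_(a < n) (`|A| * `|B|).
  by rewrite sumr_const card_ord -[RHS]mulr_natl mulrA.
apply: ler_sum => a _; rewrite normrM ler_pM //; exact: coord_le_mx_norm.
Qed.

End MatrixNorm.

Lemma quadratic_form_class (R : realType) N (Q : 'M[R]_N) k U : open U ->
  real_class_C k U (fun x => (x *m Q *m x^T) 0 0).
Proof.
move=> Uo.
apply: (@eq_real_class_C _ _ _ _
    (fun x : 'rV[R]_N => \sum_a (\sum_b x 0 b * Q b a) * x 0 a)) => //.
  by move=> x _; rewrite !mxE; apply: eq_bigr => a _; rewrite !mxE.
apply: real_class_C_sum => // a; apply: real_class_CM => //; last exact: real_class_C_coord.
apply: real_class_C_sum => // b.
by apply: real_class_CM => //; [exact: real_class_C_coord|exact: real_class_C_cst].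
Qed.

Section QuadraticMap.
Variables (R : realType) (N : nat) (C : 'M[R]_N) (Q : 'I_N -> 'M[R]_N).
Hypothesis Qsym : forall i, (Q i)^T = Q i.
Implicit Types x y z : 'rV[R]_N.

Definition quad_map x : 'rV[R]_N :=
  x *m C + \row_i (x *m Q i *m x^T) 0 0.

(** The derivative of [quad_map] at [z / 2], acting on row vectors. *)
Definition secant z : 'M[R]_N := C + \matrix_(a, i) (z *m Q i) 0 a.

(** For a quadratic map the mean value formula is exact, and the derivative is taken
    at the midpoint of [x] and [y]. *)
Lemma quad_mapB x y : quad_map y - quad_map x = (y - x) *m secant (x + y).
Proof.
apply/rowP => i; rewrite /quad_map /secant mulmxDr.
have -> : (y - x) *m (\matrix_(a, i) ((x + y) *m Q i) 0 a) =
          \row_i (y *m Q i *m y^T) 0 0 - \row_i (x *m Q i *m x^T) 0 0.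
  apply/rowP => j; rewrite [LHS]mxE [RHS]mxE [X in _ = X + _]mxE.
  rewrite [X in _ = _ + X]mxE [X in _ = _ - X]mxE.
  transitivity (((x + y) *m Q j *m (y - x)^T) 0 0).
    by rewrite [RHS]mxE; apply: eq_bigr => a _; rewrite [LHS]mulrC !mxE.
  have cross : (x *m Q j *m y^T) 0 0 = (y *m Q j *m x^T) 0 0.
    have -> : y *m Q j *m x^T = (x *m Q j *m y^T)^T.
      by rewrite !trmx_mul trmxK Qsym mulmxA.
    by rewrite [RHS]mxE.
  rewrite linearB /= mulmxBr !mulmxDl.
  have entry (A B A' B' : 'M[R]_1) :
    (A + B - (A' + B')) 0 0 = A 0 0 + B 0 0 - (A' 0 0 + B' 0 0) by rewrite !mxE.
  by rewrite entry cross; ring.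
by rewrite mulmxBl !mxE; ring.
Qed.

Lemma secant_class k U i j : open U -> real_class_C k U (fun z => secant z i j).
Proof.
move=> Uo.
apply: (@eq_real_class_C _ _ _ _ (fun z => C i j + \sum_a z 0 a * Q j a i)) => //.
  by move=> z _; rewrite !mxE.
apply: real_class_CD => //; first exact: real_class_C_cst.
apply: real_class_C_sum => // a.
by apply: real_class_CM => //; [exact: real_class_C_coord|exact: real_class_C_cst].
Qed.

Lemma quad_map_class k U j : open U -> real_class_C k U (fun x => quad_map x 0 j).
Proof.
move=> Uo; apply: (@eq_real_class_C _ _ _ _
    (fun x => \sum_a x 0 a * C a j + (x *m Q j *m x^T) 0 0)) => //.
  by move=> x _; rewrite /quad_map [RHS]mxE [X in _ = X + _]mxE [X in _ = _ + X]mxE.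
apply: real_class_CD => //; last exact: quadratic_form_class.
apply: real_class_C_sum => // a.
by apply: real_class_CM => //; [exact: real_class_C_coord|exact: real_class_C_cst].
Qed.

Lemma secant_continuous : continuous secant.
Proof.
move=> z; apply: continuous_coords => i j.
by apply: (real_class_C_continuous (secant_class 0 i j openT)); rewrite inE.
Qed.

Lemma secant_unit_near z : secant z \in unitmx ->
  \forall z' \near z, secant z' \in unitmx.
Proof.
rewrite unitmxE unitfE => nz.
have cdet : {for z, continuous (fun z => \det (secant z))}.
  apply: (real_class_C_continuous (k := 0) (U := setT)); last by rewrite inE.
  by apply: real_class_C_det => [|i j]; [exact: openT|exact/secant_class/openT].
have : \forall z' \near z, \det (secant z') != 0 by exact: (cvgr_neq0 _ cdet).
by apply: filterS => z'; rewrite unitmxE unitfE.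
Qed.

(** Newton's iteration with the derivative frozen at [x0] is a contraction of a small
    closed ball: by [quad_mapB], its secants are [1 - secant z * A], with [A] the
    inverse of the derivative at [x0] and [z] close to [x0 + x0]. *)
Lemma quad_map_locally_onto x0 e : secant (x0 + x0) \in unitmx -> 0 < e ->
  exists2 d, 0 < d & forall y, `|y - quad_map x0| < d ->
    exists2 x, `|x - x0| < e & quad_map x = y.
Proof.
set S := secant (x0 + x0) => Su e0.
pose A := invmx S.
(* [K] is such that secants closer than [1 / (2 K)] to [S] give the Lipschitz
   constant [1 / 2]; each matrix product costs a factor [N] in the norm. *)
pose K : R := N%:R * (N%:R * `|A|) + 1.
have K0 : 0 < K by rewrite ltr_wpDl ?mulr_ge0.
have near_S : \forall z \near x0 + x0, `|S - secant z| < (2 * K)^-1.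
  have /cvgrPdist_lt := @secant_continuous (x0 + x0).
  by apply; rewrite invr_gt0 mulr_gt0.
have /nbhs_normP[rho0 /= rho00 rhoS] := near_S.
pose rho := Num.min (e / 2) (rho0 / 3).
have rho_gt0 : 0 < rho by rewrite lt_min !divr_gt0.
have rho_e : rho < e by rewrite gt_min; apply/orP; left; lra.
have rho_rho0 : rho + rho < rho0.
  have : rho <= rho0 / 3 by rewrite ge_min lexx orbT.
  lra.
pose NA : R := N%:R * `|A| + 1.
have NA0 : 0 < NA by rewrite ltr_wpDl ?mulr_ge0.
(* The iteration moves the centre [x0] by at most [rho / 2]. *)
exists (rho / (2 * NA)); first by rewrite divr_gt0 // mulr_gt0.
move=> y yd.
pose T x := x - (quad_map x - y) *m A.
have T_contract x x' : `|x - x0| <= rho -> `|x' - x0| <= rho ->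
    `|T x - T x'| <= 2^-1 * `|x - x'|.
  move=> xr xr'.
  have -> : T x - T x' = (x - x') *m ((S - secant (x' + x)) *m A).
    have -> : (S - secant (x' + x)) *m A = 1%:M - secant (x' + x) *m A.
      by rewrite mulmxBl mulmxV.
    rewrite mulmxBr mulmx1 mulmxA -quad_mapB.
    have -> : quad_map x - quad_map x' = (quad_map x - y) - (quad_map x' - y).
      by rewrite opprB addrA subrK.
    rewrite [in RHS]mulmxBl /T.
    move: ((quad_map x - y) *m A) ((quad_map x' - y) *m A) => b b'.
    by rewrite !opprD !opprK addrACA.
  apply: (le_trans (mulmx_norm_le _ _)); rewrite mulrAC ler_wpM2r //.
  have near : `|S - secant (x' + x)| <= (2 * K)^-1.
    apply/ltW/rhoS; rewrite /ball_ /=.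
    have -> : x0 + x0 - (x' + x) = - ((x' - x0) + (x - x0)).
      by rewrite [RHS]opprD !opprB [RHS]addrACA -opprD.
    rewrite normrN (le_lt_trans (ler_normD _ _)) //.
    by rewrite (le_lt_trans _ rho_rho0) // lerD.
  apply: (@le_trans _ _ (N%:R * (N%:R * `|S - secant (x' + x)| * `|A|))).
    by rewrite ler_wpM2l // mulmx_norm_le.
  have -> : N%:R * (N%:R * `|S - secant (x' + x)| * `|A|) =
     (N%:R * (N%:R * `|A|)) * `|S - secant (x' + x)| :> R by ring.
  apply: (@le_trans _ _ (K * (2 * K)^-1)).
    by rewrite ler_pM // ?mulr_ge0 // lerDl.
  by rewrite invfM mulrCA divff ?gt_eqF // mulr1.
pose U := [set x | `|x - x0| <= rho].
have T_U : {homo T : x / U x >-> U x}.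
  move=> x /= xr; change (`|T x - x0| <= rho).
  have Tx0 : `|T x0 - x0| <= 2^-1 * rho.
    have -> : T x0 - x0 = (y - quad_map x0) *m A by rewrite /T addrAC subrr add0r -mulNmx opprB.
    apply: (le_trans (mulmx_norm_le _ _)).
    apply: (@le_trans _ _ (NA * (rho / (2 * NA)))).
      rewrite mulrAC ler_pM // ?mulr_ge0 //; last exact: ltW.
      by rewrite lerDl.
    rewrite le_eqVlt; apply/orP; left; apply/eqP; field; exact: lt0r_neq0.
  have := T_contract x x0 xr; rewrite subrr normr0 => /(_ (ltW rho_gt0)) Txx0.
  have -> : T x - x0 = (T x - T x0) + (T x0 - x0) by rewrite addrA subrK.
  have {}xr : `|x - x0| <= rho by [].
  apply: (le_trans (ler_normD _ _)).
  move: Tx0 Txx0 xr; move: (`|_|) (`|_|) (`|_|) => a b c; lra.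
have contr : is_contraction (mkfun_fun T_U).
  have half : 0 <= 2^-1 :> R by rewrite invr_ge0.
  exists (NngNum half); split; first by rewrite /=; lra.
  by move=> [x x'] [/= Ux Ux']; exact: T_contract.
have Uclosed : closed U.
  have -> : U = closed_ball x0 rho.
    by rewrite closed_ballE //; apply/seteqP; split=> x /=; rewrite /closed_ball_ /= distrC.
  exact: closed_ball_closed.
have [|x /= Ux] := banach_fixed_point contr Uclosed.
  by exists x0; rewrite /U /= subrr normr0 ltW.
rewrite /mkfun /T => fixx; exists x; first exact: le_lt_trans rho_e.
have Au : A \in unitmx by rewrite unitmx_inv.
have : (quad_map x - y) *m A = 0.
  by move/eqP: fixx; rewrite eq_sym -subr_eq0 addrAC subrr add0r oppr_eq0 => /eqP.
by move/(congr1 (mulmxr S)); rewrite /= mulmxKV // mul0mx => /subr0_eq.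
Qed.

End QuadraticMap.

(** * The local inverse of a quadratic map *)

Section QuadraticDiffeo.
Variables (R : realType) (N : nat) (C : 'M[R]_N) (Q : 'I_N -> 'M[R]_N).
Hypothesis Qsym : forall i, (Q i)^T = Q i.
Local Notation phi := (quad_map C Q).
Local Notation S := (secant C Q).

Section LocalInverse.
Variables (U : set 'rV[R]_N) (x0 : 'rV[R]_N).
Hypothesis Uo : open U.
Hypothesis sumU : forall x y, U x -> U y -> S (x + y) \in unitmx.

Definition local_inverse y := xget x0 [set x | U x /\ phi x = y].

Lemma quad_map_inj x y : U x -> U y -> phi x = phi y -> x = y.
Proof.
move=> Ux Uy e; have := quad_mapB C Qsym y x; rewrite e subrr.
move/(congr1 (mulmxr (invmx (S (y + x))))) => /=.
by rewrite mulmxK ?sumU // mul0mx => /esym/subr0_eq.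
Qed.

Lemma local_inverseK x : U x -> local_inverse (phi x) = x.
Proof.
move=> Ux; rewrite /local_inverse; case: xgetP => [x' _ [Ux' e]|/(_ x)].
  exact: quad_map_inj.
by case.
Qed.

Lemma quad_map_open_at x1 e : U x1 -> 0 < e ->
  exists2 d, 0 < d & forall y, `|y - phi x1| < d ->
    exists x, [/\ U x, `|x - x1| < e & phi x = y].
Proof.
move=> Ux1 e0; have /nbhs_normP[e1 /= e10 e1U] : nbhs x1 U by exact: open_nbhs_nbhs.
have [||d d0 dP] := @quad_map_locally_onto _ _ C _ Qsym x1 (Num.min e e1).
- exact: sumU.
- by rewrite lt_min e0.
exists d => // y /dP[x]; rewrite lt_min => /andP[xe xe1] xy.
by exists x; split=> //; apply: e1U; rewrite /ball_ /= distrC.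
Qed.

Lemma open_quad_map_image : open (phi @` U).
Proof.
rewrite openE => _ [x1 Ux1 <-].
have [d d0 dP] := quad_map_open_at Ux1 ltr01.
apply/(nbhs_normP (phi x1) (phi @` U)); exists d => //= y.
by rewrite /ball_ /= distrC => /dP[x [Ux _ <-]]; exists x.
Qed.

Lemma local_inverse_continuous : {in phi @` U, continuous local_inverse}.
Proof.
move=> y /set_mem[x1 Ux1 <-]; apply/(@cvgrPdist_lt _ _ _ (nbhs (phi x1))) => e e0.
have [d d0 dP] := quad_map_open_at Ux1 e0.
apply/(nbhs_normP (phi x1)); exists d => //= y'; rewrite /ball_ /= distrC => /dP[x [Ux xe <-]].
by rewrite !local_inverseK // distrC.
Qed.

(** With [y' = h e_i + y] and [x], [x'] the preimages of [y], [y'], the mean value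
    formula [h e_i = (x' - x) S (x + x')] shows that the difference quotient is
    the [i]-th row of the inverse of [S (x + x')]; it remains to use the
    continuity of the local inverse. *)
Lemma local_inverse_is_derive i j : {in phi @` U, forall y,
  is_derive y (delta_mx 0 i) (fun y => local_inverse y 0 j)
    (invmx (S (local_inverse y + local_inverse y)) i j)}.
Proof.
move=> y yV; have [x Ux xy] := set_mem yV; apply: is_derive_cvg.
set e_i : 'rV[R]_N := delta_mx 0 i.
pose z (h : R) := local_inverse y + local_inverse (h *: e_i + y).
pose G (h : R) := invmx (S (z h)) i j.
have cline : (h *: e_i + y) @[h --> (0 : R)] --> y.
  apply/(@cvgrPdist_lt _ _ _ (nbhs (0 : R))) => e e0.
  have K0 : 0 < `|e_i| + 1 by rewrite ltr_wpDl.
  apply/(nbhs_normP (0 : R)); exists (e / (`|e_i| + 1)); first by rewrite /= divr_gt0.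
  move=> h; rewrite /ball_ /= sub0r normrN ltr_pdivlMr // => he.
  rewrite opprD addrCA subrr addr0 normrN normrZ (le_lt_trans _ he) //.
  by rewrite ler_wpM2l // lerDl.
have xE : local_inverse y = x by rewrite -xy local_inverseK.
have cz : z h @[h --> (0 : R)] --> local_inverse y + local_inverse y.
  have c1 : local_inverse (h *: e_i + y) @[h --> (0 : R)] --> local_inverse y.
    exact: (cvg_comp _ _ cline (local_inverse_continuous yV)).
  have c2 : local_inverse y @[h --> (0 : R)] --> local_inverse y by exact: cvg_cst.
  exact: (cvgD c2 c1).
have cF : {for local_inverse y + local_inverse y,
            continuous (fun z => invmx (S z) i j)}.
  have unit : S (local_inverse y + local_inverse y) \in unitmx by rewrite xE sumU.
  have /nbhs_normP[e /= e0 eS] := secant_unit_near unit.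
  pose B : set 'rV[R]_N := ball (local_inverse y + local_inverse y) e.
  have Bo : open B by exact: ball_open.
  apply: (real_class_C_continuous (k := 0) (U := B)); last first.
    by rewrite inE; exact: ballxx.
  apply: real_class_C_invmx => // [z'|a b]; last exact: secant_class.
  by rewrite inE /B -ball_normE => /eS.
have cG : G h @[h --> (0 : R)^'] --> invmx (S (local_inverse y + local_inverse y)) i j.
  apply: cvg_within_filter; exact: (cvg_comp _ _ cz cF).
apply: cvg_trans cG; apply: near_eq_cvg.
have nearV : \forall h \near (0 : R), (phi @` U) (h *: e_i + y).
  by apply: cline; apply: open_nbhs_nbhs; split; [exact: open_quad_map_image|exact: set_mem].
near=> h.
have h0 : h != 0 by near: h; exact: nbhs_dnbhs_neq.
have [x' Ux' x'y] : (phi @` U) (h *: e_i + y) by near: h; exact: nbhs_dnbhs.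
rewrite /G /z -x'y local_inverseK // xE.
have : h *: e_i = (x' - x) *m S (x + x').
  by rewrite -quad_mapB // x'y xy addrK.
move/(congr1 (mulmxr (invmx (S (x + x'))))) => /=; rewrite mulmxK ?sumU //.
rewrite -scalemxAl -rowE => /rowP/(_ j); rewrite !mxE => <-.
by rewrite /GRing.scale /= mulKf.
Unshelve. all: by end_near. Qed.

(** The partial derivatives are rational functions of the coordinates of the local
    inverse, so that its regularity improves by one at each step. *)
Lemma local_inverse_class k j :
  real_class_C k (phi @` U) (fun y => local_inverse y 0 j).
Proof.
have Vo := open_quad_map_image.
have cont a : {in phi @` U, continuous (fun y => local_inverse y 0 a)}.
  move=> y yV; have cy := local_inverse_continuous yV; rewrite /continuous_at in cy.
  exact: (cvg_comp _ _ cy (@coord_continuous _ _ _ 0 a _)).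
elim: k j => [|k IH] j; first by split=> //; exact: cont.
apply: real_class_CS => // i.
exists (fun y => invmx (S (local_inverse y + local_inverse y)) i j).
  exact: local_inverse_is_derive.
apply: real_class_C_invmx => // [y /set_mem[x Ux <-]|a b].
  by rewrite local_inverseK // sumU.
apply: (@eq_real_class_C _ _ _ _ (fun y => C a b +
   \sum_c (local_inverse y 0 c + local_inverse y 0 c) * Q b c a)) => //.
  by move=> y _; rewrite !mxE; congr (_ + _); apply: eq_bigr => c _; rewrite !mxE.
apply: real_class_CD => //; first exact: real_class_C_cst.
apply: real_class_C_sum => // c; apply: real_class_CM => //.
  exact: real_class_CD.
exact: real_class_C_cst.
Qed.

End LocalInverse.

(** On a ball of radius [e] around [x0], all the sums [x + y] are within [2 e] of
    [x0 + x0], where the secants are invertible. *)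
Theorem quad_map_diffeo (x0 : 'rV[R]_N) (W : set 'rV[R]_N) :
  nbhs x0 W -> S (x0 + x0) \in unitmx ->
  exists (U V : set 'rV[R]_N) psi,
    [/\ open U, open V, U x0, U `<=` W & diffeomorphism_on U V phi psi].
Proof.
move=> /nbhs_normP[e1 /= e10 e1W] /(secant_unit_near (C := C))/nbhs_normP[e2 /= e20 e2S].
pose e := Num.min e1 (e2 / 2).
have e0 : 0 < e by rewrite lt_min e10 divr_gt0.
have ele1 : e <= e1 by rewrite ge_min lexx.
have ele2 : e + e <= e2.
  have : e <= e2 / 2 by rewrite ge_min lexx orbT.
  lra.
pose U : set 'rV[R]_N := ball x0 e.
have UE x : U x -> `|x0 - x| < e by rewrite /U -ball_normE.
have Uo : open U by exact: ball_open.
have sumU x y : U x -> U y -> S (x + y) \in unitmx.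
  move=> /UE Ux /UE Uy; apply: e2S; rewrite /ball_ /= opprD addrACA.
  by rewrite (le_lt_trans (ler_normD _ _)) // (lt_le_trans _ ele2) // ltrD.
exists U, (phi @` U), (local_inverse U x0); split=> //.
- exact: open_quad_map_image.
- exact: ballxx.
- by move=> x /UE Ux; apply: e1W; rewrite /ball_ /= (lt_le_trans Ux).
split=> //.
- by move=> x /set_mem Ux; exact: local_inverseK.
- by move=> k; apply: class_C_coords => // j; exact: quad_map_class.
- move=> k; apply: class_C_coords => [|j]; first exact: open_quad_map_image.
  exact: local_inverse_class.
Qed.

End QuadraticDiffeo.

(** * Regular common zeros of quadratic forms *)

Lemma row_free_complement (F : fieldType) k m (D : 'M[F]_(m, k + m)) :
  row_free D -> exists B : 'M[F]_(k, k + m), col_mx B D \in unitmx.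
Proof.
move=> Df; have rk : \rank (D^C)%MS = k by rewrite mxrank_compl (eqP Df) addnK.
have [B eB] : exists B : 'M[F]_(k, k + m), (B :=: D^C)%MS.
  have cast k' : \rank (D^C)%MS = k' -> exists B : 'M[F]_(k', k + m), (B :=: D^C)%MS.
    by move=> <-; exists (row_base (D^C)%MS); exact: eq_row_base.
  exact: cast.
exists B; rewrite -row_full_unit -sub1mx.
apply: submx_trans (_ : (D + D^C <= _)%MS); first by rewrite sub1mx addsmx_compl_full.
by rewrite -addsmxE addsmxC addsmxS // eB.
Qed.

(** The rows are half the gradients of the forms [z Q_l z^T]. *)
Definition gradients (R : realType) N m (Q : 'I_m -> 'M[R]_N) (z : 'rV[R]_N) :
    'M[R]_(m, N) :=
  \matrix_(l, a) (z *m Q l) 0 a.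

Section QuadraticLevelSet.
Variables (R : realType) (k m : nat) (Q : 'I_m -> 'M[R]_(k + m)).
Hypothesis Qsym : forall l, (Q l)^T = Q l.

Definition padded_forms (i : 'I_(k + m)) : 'M[R]_(k + m) :=
  if fintype.split i is inr l then Q l else 0.

(** The first [k] coordinates are linear, the last [m] are the quadratic forms. *)
Definition straightening (B : 'M[R]_(k, k + m)) :=
  quad_map (row_mx B^T 0) padded_forms.

Lemma padded_lshift l : padded_forms (lshift m l) = 0.
Proof. by rewrite /padded_forms (fintype.unsplitK (inl l)). Qed.

Lemma padded_rshift l : padded_forms (rshift k l) = Q l.
Proof. by rewrite /padded_forms (fintype.unsplitK (inr l)). Qed.

Lemma padded_forms_sym i : (padded_forms i)^T = padded_forms i.
Proof.
case: (fintype.split_ordP i) => l ->; first by rewrite padded_lshift trmx0.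
by rewrite padded_rshift.
Qed.

Lemma straightening_secant B z :
  secant (row_mx B^T 0) padded_forms z = (col_mx B (gradients Q z))^T.
Proof.
apply/matrixP => a i; rewrite tr_col_mx /secant [LHS]mxE [X in _ + X]mxE.
case: (fintype.split_ordP i) => l ->.
  by rewrite !row_mxEl padded_lshift mulmx0 [X in _ + X]mxE addr0.
by rewrite !row_mxEr padded_rshift [X in X + _]mxE add0r !mxE.
Qed.

Lemma straightening_rshift B x l :
  straightening B x 0 (rshift k l) = (x *m Q l *m x^T) 0 0.
Proof.
rewrite /straightening /quad_map mxE mul_mx_row mulmx0 row_mxEr.
by rewrite [X in X + _]mxE add0r mxE padded_rshift.
Qed.

(** The linear coordinates are chosen to complete the gradients at [x] to a basis,
    which makes the derivative of [straightening] invertible at [x]. *)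
Lemma smooth_submanifold_regular_zeros (S : set 'rV[R]_(k + m)) :
  (forall x, S x -> row_free (gradients Q x) /\
     \forall y \near x, S y <-> forall l, (y *m Q l *m y^T) 0 0 = 0) ->
  smooth_submanifold k S.
Proof.
move=> reg; split=> [|x Sx]; first exact: leq_addr.
have [free locS] := reg x Sx.
have free2 : row_free (gradients Q (x + x)).
  have -> : gradients Q (x + x) = 2 *: gradients Q x.
    apply/matrixP => l a; rewrite [LHS]mxE [RHS]mxE mulmxDl [LHS]mxE.
    by rewrite [gradients _ _ _ _]mxE; ring.
  rewrite /row_free (eqmx_scale _ (_ : 2 != 0)) //; exact: pnatr_eq0.
have [B unit] := row_free_complement free2.
have [|U [V [psi [Uo Vo Ux UW dif]]]] :=
    quad_map_diffeo (C := row_mx B^T 0) padded_forms_sym locS.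
  by rewrite straightening_secant unitmx_tr.
exists U, V, (straightening B), psi; split=> //.
have [UV _ _ _] := dif; rewrite -UV.
apply/seteqP; split=> [_ [y [Sy Uy] <-]|z [zero [y Uy yz]]].
  split; last by exists y.
  move=> i; case: (fintype.split_ordP i) => l ->; first by rewrite /= leqNgt ltn_ord.
  by move=> _; rewrite straightening_rshift; apply: (UW y Uy).1.
exists y => //; split=> //; apply: (UW y Uy).2 => l.
rewrite -yz in zero.
by rewrite -(straightening_rshift B) zero //= leq_addr.
Qed.

End QuadraticLevelSet.

(** The rank of the gradients at one point of [S] bounds [m]. *)
Theorem smooth_submanifold_quadratic_level_set (R : realType) (N m : nat)
    (Q : 'I_m -> 'M[R]_N) (S : set 'rV[R]_N) :
  (forall l, (Q l)^T = Q l) -> S !=set0 ->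
  (forall x, S x -> row_free (gradients Q x) /\
     \forall y \near x, S y <-> forall l, (y *m Q l *m y^T) 0 0 = 0) ->
  (m <= N)%N /\ smooth_submanifold (N - m) S.
Proof.
move=> Qsym [x0 Sx0] reg.
have mN : (m <= N)%N.
  have [/eqP rk _] := reg x0 Sx0.
  by apply: leq_trans (rank_leq_col (gradients Q x0)); rewrite rk.
split=> //; move: (N - m)%N (subnK mN) => k eN.
move: Q S x0 Sx0 Qsym reg {mN}; rewrite -{N}eN => Q S _ _ Qsym reg.
exact: smooth_submanifold_regular_zeros reg.
Qed.

(** * Disks in the Euclidean plane *)

Section EuclideanPlane.
Variable R : realType.
Implicit Types (p q z v : 'rV[R]_2) (r s : R).

Lemma euclidean_norm_ge0 v : 0 <= euclidean_norm v.
Proof. exact: sqrtr_ge0. Qed.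

Lemma sqr_euclidean_norm v : euclidean_norm v ^+ 2 = \sum_(a < 2) v 0 a ^+ 2.
Proof. by rewrite sqr_sqrtr // sumr_ge0 // => a _; exact: sqr_ge0. Qed.

Lemma euclidean_norm_distC p q : euclidean_norm (p - q) = euclidean_norm (q - p).
Proof.
by rewrite /euclidean_norm; congr Num.sqrt; apply: eq_bigr => a _; rewrite !mxE; ring.
Qed.

Lemma ler_euclidean_normD v z :
  euclidean_norm (v + z) <= euclidean_norm v + euclidean_norm z.
Proof.
have [v0 z0] := (euclidean_norm_ge0 v, euclidean_norm_ge0 z).
rewrite -ler_sqr ?nnegrE ?addr_ge0 ?euclidean_norm_ge0 //.
rewrite sqrrD !sqr_euclidean_norm !big_ord_recl !big_ord0 !mxE !addr0.
have vE := sqr_euclidean_norm v; have zE := sqr_euclidean_norm z.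
rewrite !big_ord_recl !big_ord0 !addr0 in vE zE.
set a := v 0 0 in vE *; set b := v 0 _ in vE *.
set c := z 0 0 in zE *; set d := z 0 _ in zE *.
suff : a * c + b * d <= euclidean_norm v * euclidean_norm z by lra.
have vz := mulr_ge0 v0 z0.
rewrite (le_trans (ler_norm _)) // -ler_sqr ?nnegrE // real_normK ?num_real //.
rewrite exprMn vE zE -subr_ge0.
have -> : (a ^+ 2 + b ^+ 2) * (c ^+ 2 + d ^+ 2) - (a * c + b * d) ^+ 2 =
  (a * d - b * c) ^+ 2 by ring.
exact: sqr_ge0.
Qed.

Lemma euclidean_normZ c v : 0 <= c -> euclidean_norm (c *: v) = c * euclidean_norm v.
Proof.
move=> c0; rewrite /euclidean_norm -{2}(ger0_norm c0) -sqrtr_sqr -sqrtrM ?sqr_ge0 //.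
by rewrite mulr_sumr; congr Num.sqrt; apply: eq_bigr => a _; rewrite mxE exprMn.
Qed.

(** Moving [z] slightly away from [p] stays in the disk. *)
Lemma interior_disk_lt p r z : 0 < r -> (disk p r)° z -> euclidean_norm (z - p) < r.
Proof.
move=> r0 /(nbhs_normP z (disk p r))[e /= e0 ez].
have [p0|pos] := lerP (euclidean_norm (z - p)) 0; first exact: le_lt_trans r0.
have K0 : 0 < `|z - p| + 1 by rewrite ltr_wpDl.
pose t := e / (2 * (`|z - p| + 1)).
have t0 : 0 < t by rewrite divr_gt0 // mulr_gt0.
have : disk p r (z + t *: (z - p)).
  apply: ez; rewrite /ball_ /= opprD addrA subrr sub0r normrN normrZ gtr0_norm //.
  have : t * (`|z - p| + 1) = e / 2.
    by rewrite /t; field; rewrite gt_eqF.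
  by move: (normr_ge0 (z - p)) => ? tE; lra.
rewrite /disk /=; have -> : z + t *: (z - p) - p = (1 + t) *: (z - p).
  by rewrite scalerDl scale1r addrAC.
rewrite euclidean_normZ ?addr_ge0 ?(ltW t0) // => le.
by have := mulr_gt0 t0 pos; lra.
Qed.

Lemma interior_disks_disjoint p q r s : 0 < r ->
  r + s <= euclidean_norm (p - q) -> (disk p r)° `&` (disk q s)° = set0.
Proof.
move=> r0 le; apply/seteqP; split=> // z [zp /interior_subset zq].
have {}zp := interior_disk_lt r0 zp; rewrite /disk /= in zq.
have := ler_euclidean_normD (p - z) (z - q).
by rewrite addrA subrK euclidean_norm_distC in zp *; rewrite /=; lra.
Qed.

End EuclideanPlane.

(** * The quadratic forms of the contacts *)

Section RankOneForms.
Variables (R : realType) (N : nat).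
Implicit Types x u : 'rV[R]_N.

Lemma dot_delta x a : (x *m (delta_mx 0 a : 'rV_N)^T) 0 0 = x 0 a.
Proof. by rewrite trmx_delta -colE mxE. Qed.

Lemma rank_one_form x u : (x *m (u^T *m u) *m x^T) 0 0 = (x *m u^T) 0 0 ^+ 2.
Proof.
rewrite mulmxA -mulmxA mxE big_ord1 expr2; congr (_ * _).
by rewrite -[u in u *m _]trmxK -trmx_mul mxE.
Qed.

Lemma rank_one_gradient x u b : (x *m (u^T *m u)) 0 b = (x *m u^T) 0 0 * u 0 b.
Proof. by rewrite mulmxA mxE big_ord1. Qed.

End RankOneForms.

Section ContactForms.
Variables (R : realType) (n : nat).
Implicit Types (x y : 'rV[R]_(n * 2 + n)) (ij : 'I_n * 'I_n).

Definition center_coord (i : 'I_n) (a : 'I_2) : 'I_(n * 2 + n) :=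
  lshift n (mxvec_index i a).
Definition radius_coord (i : 'I_n) : 'I_(n * 2 + n) := rshift (n * 2) i.

Lemma centerE x i a : center x i 0 a = x 0 (center_coord i a).
Proof. by rewrite !mxE. Qed.

Lemma radiusE x i : radius x i = x 0 (radius_coord i).
Proof. by rewrite /radius mxE. Qed.

Lemma center_coord_eq i j a b :
  (center_coord i a == center_coord j b) = (i == j) && (a == b).
Proof.
rewrite eq_lshift; apply/eqP/andP => [e|[/eqP-> /eqP->]//].
have [g gK _] := curry_mxvec_bij n 2.
have := gK (i, a) isT; rewrite /= e => ei.
by have := gK (j, b) isT; rewrite /= ei => -[-> ->].
Qed.

Definition center_diff ij a : 'rV[R]_(n * 2 + n) :=
  delta_mx 0 (center_coord ij.1 a) - delta_mx 0 (center_coord ij.2 a).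
Definition radius_sum ij : 'rV[R]_(n * 2 + n) :=
  delta_mx 0 (radius_coord ij.1) + delta_mx 0 (radius_coord ij.2).

(** A sum of squares of linear forms: the coordinates of the difference of the two
    centres, and minus the sum of the two radii. *)
Definition contact_form ij : 'M[R]_(n * 2 + n) :=
  \sum_a (center_diff ij a)^T *m center_diff ij a
  - (radius_sum ij)^T *m radius_sum ij.

Lemma contact_form_sym ij : (contact_form ij)^T = contact_form ij.
Proof.
rewrite /contact_form linearB /= trmx_mul trmxK linear_sum; congr (_ - _).
by apply: eq_bigr => a _; rewrite /= trmx_mul trmxK.
Qed.

Lemma dot_center_diff x ij a :
  (x *m (center_diff ij a)^T) 0 0 = (center x ij.1 - center x ij.2) 0 a.
Proof.
rewrite /center_diff linearB /= mulmxBr [LHS]mxE [X in _ + X]mxE !dot_delta.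
by rewrite [RHS]mxE [X in _ = _ + X]mxE !centerE.
Qed.

Lemma dot_radius_sum x ij :
  (x *m (radius_sum ij)^T) 0 0 = radius x ij.1 + radius x ij.2.
Proof. by rewrite /radius_sum linearD /= mulmxDr [LHS]mxE !dot_delta !radiusE. Qed.

Lemma contact_formE x ij : (x *m contact_form ij *m x^T) 0 0 =
  euclidean_norm (center x ij.1 - center x ij.2) ^+ 2
  - (radius x ij.1 + radius x ij.2) ^+ 2.
Proof.
rewrite /contact_form mulmxBr mulmxBl [LHS]mxE [X in _ + X]mxE rank_one_form.
rewrite dot_radius_sum sqr_euclidean_norm; congr (_ - _).
rewrite mulmx_sumr mulmx_suml summxE; apply: eq_bigr => a _.
by rewrite rank_one_form dot_center_diff.
Qed.

Lemma contact_gradientE x ij b : (x *m contact_form ij) 0 b =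
  \sum_a (center x ij.1 - center x ij.2) 0 a * center_diff ij a 0 b
  - (radius x ij.1 + radius x ij.2) * radius_sum ij 0 b.
Proof.
rewrite /contact_form mulmxBr [LHS]mxE [X in _ + X]mxE rank_one_gradient.
rewrite dot_radius_sum; congr (_ - _).
rewrite mulmx_sumr summxE; apply: eq_bigr => a _.
by rewrite rank_one_gradient dot_center_diff.
Qed.

Lemma contact_gradient_center x ij i a :
  (x *m contact_form ij) 0 (center_coord i a) =
  (center x ij.1 - center x ij.2) 0 a * ((ij.1 == i)%:R - (ij.2 == i)%:R).
Proof.
rewrite contact_gradientE.
have -> : radius_sum ij 0 (center_coord i a) = 0.
  by rewrite !mxE !eq_lrshift addr0.
rewrite mulr0 subr0 (bigD1 a) //= big1 ?addr0 => [|b ba]; last first.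
  by rewrite [center_diff _ _ _ _]mxE [(- delta_mx _ _) _ _]mxE ![delta_mx _ _ _ _]mxE
    !center_coord_eq [a == b]eq_sym (negPf ba) !andbF subr0 mulr0.
congr (_ * _).
by rewrite [LHS]mxE [(- delta_mx _ _) _ _]mxE ![delta_mx _ _ _ _]mxE
  !center_coord_eq !eqxx !andbT /= ![i == _]eq_sym.
Qed.

Lemma contact_gradient_radius x ij i :
  (x *m contact_form ij) 0 (radius_coord i) =
  - ((radius x ij.1 + radius x ij.2) * ((ij.1 == i)%:R + (ij.2 == i)%:R)).
Proof.
rewrite contact_gradientE big1 ?sub0r => [|a _]; last first.
  by rewrite [center_diff _ _ _ _]mxE [(- delta_mx _ _) _ _]mxE ![delta_mx _ _ _ _]mxE !eq_rlshift
     subr0 mulr0.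
by rewrite [radius_sum _ _ _]mxE ![delta_mx _ _ _ _]mxE !eq_rshift /= ![i == _]eq_sym.
Qed.

End ContactForms.

(** * Packings with a given contact graph *)

Section ContactGraph.
Variables (R : realType) (n m : nat) (G : rel 'I_n) (e : 'I_m -> 'I_n * 'I_n).
Hypothesis G_sym : symmetric G.
Hypothesis e_inj : injective e.
Hypothesis e_lt : forall l, ((e l).1 < (e l).2)%N.
Hypothesis e_edge : forall l, G (e l).1 (e l).2.
Hypothesis e_onto : forall i j : 'I_n, (i < j)%N -> G i j -> exists l, e l = (i, j).
Implicit Types x y : 'rV[R]_(n * 2 + n).

Definition edge_form l : 'M[R]_(n * 2 + n) := contact_form R (e l).

(** A linear combination of the contact forms, which are indexed by ordered pairs, seen
    as a symmetric stress. *)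
Definition stress_weight (u : 'rV[R]_m) i j :=
  \sum_l u 0 l * ((e l == (i, j))%:R + (e l == (j, i))%:R).

Lemma sum_stress_weight u i (F : 'I_n -> R) :
  \sum_j stress_weight u i j * F j =
  \sum_l u 0 l * (((e l).1 == i)%:R * F (e l).2 + ((e l).2 == i)%:R * F (e l).1).
Proof.
rewrite /stress_weight; under eq_bigr => j _ do rewrite mulr_suml.
rewrite exchange_big /=; apply: eq_bigr => l _.
under eq_bigr => j _ do rewrite -mulrA mulrDl.
have pairE (p : 'I_n * 'I_n) j k : (p == (j, k)) = (p.1 == j) && (p.2 == k).
  by case: p.
rewrite -mulr_sumr big_split /=; congr (_ * (_ + _)).
  rewrite (bigD1 (e l).2) //= big1 ?addr0 => [|j ne].
    by rewrite pairE eqxx andbT.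
  by rewrite pairE [_.2 == j]eq_sym (negPf ne) andbF mul0r.
rewrite (bigD1 (e l).1) //= big1 ?addr0 => [|j ne]; first by rewrite pairE eqxx.
by rewrite pairE [_.1 == j]eq_sym (negPf ne) mul0r.
Qed.

Lemma packing_dist x i j : packings_with_contact_graph G x -> i != j ->
  radius x i + radius x j <= euclidean_norm (center x i - center x j).
Proof.
by move=> [_ /(_ i j)/[apply]] /=; case: ifP => _ => [->|/ltW].
Qed.

(** The coefficients of a linear relation between the gradients form a stress: the
    components of the relation along the centres and the radius of [i] are the
    equilibrium conditions at [i]. *)
Lemma contact_gradients_free x : packings_with_contact_graph G x ->
  row_free (gradients edge_form x).
Proof.
move=> Sx; have [[r0 _] cG] := Sx.
suff ker (u : 'rV_m) : u *m gradients edge_form x = 0 -> u = 0.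
  rewrite -kermx_eq0; apply/eqP/row_matrixP => k; rewrite row0; apply: ker.
  by rewrite -row_mul mulmx_ker row0.
move=> ug.
have grad b : \sum_l u 0 l * (x *m edge_form l) 0 b = 0.
  have /rowP/(_ b) := ug; rewrite [LHS]mxE [RHS]mxE => gb.
  by apply: etrans gb; apply: eq_bigr => l _; rewrite [gradients _ _ _ _]mxE.
have norm2 i j : euclidean_norm (center x i - center x j) ^+ 2 =
   (center x i 0 0 - center x j 0 0) ^+ 2 + (center x i 0 1 - center x j 0 1) ^+ 2.
  rewrite sqr_euclidean_norm !big_ord_recl big_ord0 addr0.
  have -> : lift ord0 ord0 = 1 :> 'I_2 by apply: val_inj.
  by rewrite !mxE.
have rr0 i j : 0 <= radius x i + radius x j by rewrite addr_ge0 ?ltW.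
have w0 : forall i j, stress_weight u i j = 0.
  apply: (@contact_stress_trivial R 'I_n (fun i => center x i 0 0)
    (fun i => center x i 0 1) (radius x)) => //.
  - by move=> i j ne; rewrite -norm2 ler_sqr ?nnegrE ?euclidean_norm_ge0 // packing_dist.
  - by move=> i j; apply: eq_bigr => l _; rewrite [X in _ * X]addrC.
  - move=> i j nz.
    have /existsP[l ijl] : [exists l, (e l == (i, j)) || (e l == (j, i))].
      apply: contraNT nz => /existsPn none; apply/eqP/big1 => l _.
      by have := none l; rewrite negb_or => /andP[/negPf-> /negPf->]; rewrite addr0 mulr0.
    have [lt Ge] := (e_lt l, e_edge l).
    have [nij Gij] : i != j /\ G i j.
      case/orP: ijl => /eqP el; rewrite el /= in lt Ge.
        by rewrite Ge -val_eqE /= ltn_eqF.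
      by rewrite G_sym Ge -val_eqE /= gtn_eqF.
    by have := cG i j nij; rewrite Gij -norm2 => /= ->.
  - move=> i; rewrite (sum_stress_weight _ _ (fun j => center x i 0 0 - center x j 0 0)).
    apply: etrans (grad (center_coord i 0)); apply: eq_bigr => l _; congr (_ * _).
    rewrite contact_gradient_center [fun_of_matrix (_ + _) _ _]mxE [fun_of_matrix (- _) _ _]mxE.
    by case: eqP => [->|_]; case: eqP => [->|_] /=; ring.
  - move=> i; rewrite (sum_stress_weight _ _ (fun j => center x i 0 1 - center x j 0 1)).
    apply: etrans (grad (center_coord i 1)); apply: eq_bigr => l _; congr (_ * _).
    rewrite contact_gradient_center [fun_of_matrix (_ + _) _ _]mxE [fun_of_matrix (- _) _ _]mxE.
    by case: eqP => [->|_]; case: eqP => [->|_] /=; ring.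
  - move=> i; rewrite (sum_stress_weight _ _ (fun j => radius x i + radius x j)).
    apply: oppr_inj; rewrite oppr0; apply: etrans (grad (radius_coord i)).
    rewrite -sumrN; apply: eq_bigr => l _; rewrite -mulrN; congr (_ * _).
    rewrite contact_gradient_radius; congr (- _).
    by case: eqP => [->|_]; case: eqP => [->|_] /=; ring.
(* Only [e l] itself contributes to the weight of the pair [e l], as [e] is
   injective and lists increasing pairs. *)
apply/rowP => l; rewrite [RHS]mxE; apply: etrans (w0 (e l).1 (e l).2).
rewrite /stress_weight (bigD1 l) //= -surjective_pairing eqxx big1 => [|k kl].
  case: eqP => [el|_]; last by rewrite !addr0 mulr1.
  by have := e_lt l; rewrite {1}el /=; have := e_lt l; lia.
rewrite (inj_eq e_inj) (negPf kl) add0r; case: eqP => [ek|_]; last by rewrite mulr0.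
by have := e_lt k; rewrite ek /=; have := e_lt l; lia.
Qed.

(** The equations force the contacts, since the sums of radii are positive; the
    inequalities that hold at [x] persist nearby, and they imply that the
    interiors are disjoint. *)
Lemma packings_near_zeros x : packings_with_contact_graph G x ->
  \forall y \near x, packings_with_contact_graph G y <->
    forall l, (y *m edge_form l *m y^T) 0 0 = 0.
Proof.
move=> Sx; have [[r0 _] cG] := Sx.
have near_r : \forall y \near x, forall i, 0 < radius y i.
  apply: (@filter_forall _ _ _ (nbhs x) _) => i.
  have ci : {for x, continuous (fun y => radius y i)}.
    have -> : (fun y => radius y i) = (fun y => y 0 (radius_coord i)).
      by apply/funext => y; exact: radiusE.
    exact: coord_continuous.
  by have /cvgr_gt := ci; apply; exact: r0.
have near_d : \forall y \near x, forall ij : 'I_n * 'I_n,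
    (ij.1 != ij.2) && ~~ G ij.1 ij.2 -> 0 < (y *m contact_form R ij *m y^T) 0 0.
  apply: (@filter_forall _ _ _ (nbhs x) _) => ij.
  have [/andP[ne nG]|_] := boolP ((ij.1 != ij.2) && ~~ G ij.1 ij.2); last exact: nearW.
  have cij : {for x, continuous (fun y => (y *m contact_form R ij *m y^T) 0 0)}.
    by apply: (real_class_C_continuous (quadratic_form_class _ 0 openT)) => //; rewrite inE.
  have pos : 0 < (x *m contact_form R ij *m x^T) 0 0.
    rewrite contact_formE subr_gt0 ltr_sqr ?nnegrE ?euclidean_norm_ge0 ?addr_ge0 ?ltW //.
    by have := cG _ _ ne; rewrite (negPf nG).
  have : \forall y \near x, 0 < (y *m contact_form R ij *m y^T) 0 0.
    by have /cvgr_gt := cij; apply.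
  by apply: filterS => y.
near=> y.
have ry : forall i, 0 < radius y i by near: y.
have dy : forall ij : 'I_n * 'I_n,
    (ij.1 != ij.2) && ~~ G ij.1 ij.2 -> 0 < (y *m contact_form R ij *m y^T) 0 0.
  by near: y.
split=> [[_ cy] l|zero].
  rewrite /edge_form contact_formE.
  have ne : (e l).1 != (e l).2 by rewrite -val_eqE /= ltn_eqF.
  by have := cy _ _ ne; rewrite e_edge => /= ->; rewrite subrr.
have zeroG i j : i != j -> G i j ->
    euclidean_norm (center y i - center y j) = radius y i + radius y j.
  have lt_case (a b : 'I_n) : (a < b)%N -> G a b ->
      euclidean_norm (center y a - center y b) = radius y a + radius y b.
    move=> lt Gab; have [l el] := e_onto lt Gab.
    have := zero l; rewrite /edge_form contact_formE el /= => /subr0_eq/eqP.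
    by rewrite eqrXn2 ?euclidean_norm_ge0 ?addr_ge0 ?ltW // => /eqP.
  rewrite neq_ltn => /orP[lt Gij|lt Gij]; first exact: lt_case.
  by rewrite euclidean_norm_distC [RHS]addrC lt_case // G_sym.
have contacts i j : i != j -> let d := euclidean_norm (center y i - center y j) in
    if G i j then d = radius y i + radius y j else radius y i + radius y j < d.
  move=> ne /=; case: ifPn => [Gij|nG]; first exact: zeroG.
  have := dy (i, j); rewrite ne nG contact_formE subr_gt0 => /(_ isT).
  by rewrite ltr_sqr ?nnegrE ?euclidean_norm_ge0 ?addr_ge0 ?ltW.
split=> //; split=> // i j ne; apply: interior_disks_disjoint => //.
by have := contacts i j ne => /=; case: ifP => _ => [->|/ltW].
Unshelve. all: by end_near. Qed.

End ContactGraph.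

Lemma card_edges n (G : rel 'I_n) : symmetric G -> irreflexive G ->
  #|edges G| = #|[set ij : 'I_n * 'I_n | (ij.1 < ij.2)%N && G ij.1 ij.2]%SET|.
Proof.
move=> G_sym G_irr; set A := [set ij | _]%SET.
have -> : edges G = ((fun ij : 'I_n * 'I_n => [set ij.1; ij.2]) @: A)%SET.
  apply/setP => s; apply/imsetP/imsetP => -[[i j] /=].
    rewrite inE /= => Gij ->; have [lt|gt|eq] := ltngtP i j.
    - by exists (i, j) => //; rewrite inE /= lt.
    - by exists (j, i); [rewrite inE /= gt G_sym | rewrite /= finset.setUC].
    - by move: Gij; rewrite (val_inj eq) G_irr.
  by rewrite inE /= => /andP[_ Gij] ->; exists (i, j); rewrite ?inE.
apply: card_in_imset => -[i j] [k l]; rewrite !inE /= => /andP[ij _] /andP[kl _] eq.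
have : i \in [set k; l]%SET by rewrite -eq !inE eqxx.
have : j \in [set k; l]%SET by rewrite -eq !inE eqxx orbT.
rewrite !inE => /orP[] /eqP ej /orP[] /eqP ei; rewrite ei ej // in ij *.
all: by move: ij kl; lia.
Qed.

Theorem proposition2p12 (R : realType) (n m : nat) (G : rel 'I_n)
    (G_sym : symmetric G) (G_irr : irreflexive G) (G_edges : #|edges G| = m)
    (SG_nonempty : @packings_with_contact_graph R n G !=set0) :
  (m <= 3 * n)%N /\
  smooth_submanifold (3 * n - m) (@packings_with_contact_graph R n G).
Proof.
subst m; rewrite card_edges //.
set A := [set ij | _]%SET.
pose e (l : 'I_#|A|) : 'I_n * 'I_n := enum_val l.
have eA l : ((e l).1 < (e l).2)%N && G (e l).1 (e l).2.
  by have := enum_valP l; rewrite inE.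
have -> : (3 * n)%N = (n * 2 + n)%N by lia.
apply: (@smooth_submanifold_quadratic_level_set _ _ _ (edge_form R e)) => //.
  by move=> l; exact: contact_form_sym.
move=> x Sx; split.
  apply: contact_gradients_free Sx => //; first exact: enum_val_inj.
  - by move=> l; have /andP[] := eA l.
  - by move=> l; have /andP[] := eA l.
apply: packings_near_zeros Sx => //.
- by move=> l; have /andP[] := eA l.
- by move=> l; have /andP[] := eA l.
move=> i j lt Gij; have ijA : (i, j) \in A by rewrite inE /= lt.
by exists (enum_rank_in ijA (i, j)); rewrite /e enum_rankK_in.
Qed.
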